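(* There exists a transcendental entire function $f:\mathbb{C}\to\mathbb{C}$ such that all of the following hold: (a) for every nonempty open set $U\subset\mathbb{C}$ there is an integer $N(U)$ such that for every $n\in\mathbb{N}$, $$n\geq N(U)\quad\Longrightarrow\quad f^{(n)}\text{ has a zero in }U;$$ (b) $f$ has order exactly two; (c) $|f(z)|\leq\sqrt{2}\,\exp(|z|^2)$ for all $z\in\mathbb{C}$; (d) (consequently) for every strictly increasing sequence $(n_k)_{k\geq 0}$ in $\mathbb{N}$, the union $\bigcup_{k\geq 0}\{z\in\mathbb{C}: f^{(n_k)}(z)=0\}$ is dense in $\mathbb{C}$.
   Context: $\mathbb{N}=\{0,1,2,\ldots\}$, and $f^{(n)}$ denotes the $n$-th derivative of $f$ (with $f^{(0)}=f$). An entire function is transcendental if it is not a polynomial. The order of a nonconstant entire function $f$ is $\rho(f)=\limsup_{r\to\infty}\frac{\log\log M(r)}{\log r}$, where $M(r)=\max_{|z|=r}|f(z)|$. *)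

(* Defs.v *)
From Stdlib Require Import Reals.
From Coquelicot Require Import Coquelicot.
Open Scope R_scope.

Definition entire (f : C -> C) : Prop :=
  forall z : C, @ex_derive C_AbsRing C_NormedModule f z.

Definition polynomial (f : C -> C) : Prop :=
  exists (d : nat) (a : nat -> C),
    forall z : C, f z = sum_n (fun k : nat => (a k * z ^ k)%C) d.

Definition transcendental_entire (f : C -> C) : Prop :=
  entire f /\ ~ polynomial f.

(* [C_derive] is the value of the complex derivative wherever the latter
   exists ([is_C_derive_unique]); for entire [f] all iterates are entire, so
   [C_derive_n f n] is the n-th derivative. *)
Definition C_derive_n (f : C -> C) (n : nat) : C -> C :=
  Nat.iter n C_derive f.

(* For continuous [f] and [0 <= r] the supremum is finite and attained, so
   it is the maximum of |f| over the circle |z| = r. *)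
Definition max_modulus (f : C -> C) (r : R) : R :=
  real (Lub_Rbar (fun y : R => exists z : C, Cmod z = r /\ y = Cmod (f z))).

(* inf over a of sup over r > a of u r, in the extended reals *)
Definition LimSup_p_infty (u : R -> R) : Rbar :=
  Rbar_glb (fun s : Rbar => exists a : R,
    s = Lub_Rbar (fun y : R => exists r : R, a < r /\ y = u r)).

(* [ln x] is 0 for [x <= 0].  When [f] is entire and nonconstant, its maximum
   modulus tends to infinity, so this convention does not affect the limsup. *)
Definition entire_order (f : C -> C) : Rbar :=
  LimSup_p_infty (fun r : R => ln (ln (max_modulus f r)) / ln r).

Definition dense_in_C (D : C -> Prop) : Prop :=
  forall U : C -> Prop, open U -> (exists z : C, U z) ->
    exists z : C, U z /\ D z.

(* Main.v *)
Require Import Defs.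
From Stdlib Require Import Reals Lra Lia Arith List.
From Coquelicot Require Import Coquelicot.
Open Scope R_scope.
(** The function is the lacunary series [f z = sum z^m / sqrt (m!)] over the exponents
    [m = lam j], whose gaps [lam (j + 1) - lam j = sqrt j + 1] are of order [m^(1/3)].

    Every statement about size comes from the coefficients.  The arithmetic-geometric mean
    inequality compares [|z|^m / sqrt (m!)] with [(2 |z|^2)^m / m!] and [2^-m], whose sums give
    [|f z| <= sqrt 2 * exp (|z|^2)] ([Cmod_lac_le]).  Conversely, the single term of
    exponent [m] is at least [exp m] at [z = e sqrt m] ([lac_large]), so the order is two.

    For the zeros, the [n]-th derivative has terms [weight n k * z^k] for [n + k] an exponent.
    Over all [k] the numbers [B k = weight n k * r^k] form a log-concave sequence which peaks at
    [k] close to [r sqrt n], with width of order [sqrt k], that is [n^(1/4)].  The gaps, of order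
    [n^(1/3)], are much wider than the peak, so at each point at most two terms matter.  At a
    radius [r] where the terms of two consecutive exponents [k0] and [k1 = k0 + g] have equal
    size ([balanced_radius]), all the others are smaller by a factor of about
    [exp (- g^2 / (4 k1))] or better ([two_peak_decay], [weighted_decay]).  The two dominant
    terms cancel exactly at the [g] points of the circle with [zeta^g = - r^g], and a
    simplified Newton iteration started there converges to a true zero of the derivative at
    relative distance at most [1 / (32 k1^2)] ([two_term_zero], [shift_lac_zero]).

    These approximate zeros become dense: on one circle they are [2 pi r / g] apart, and
    consecutive balanced radii differ by about [g / sqrt n], which tends to zero because
    [n^(1/3)] is much smaller than [n^(1/2)].  Hence every disc contains a zero of
    every derivative of large enough order ([zeros_eventually_near]).  An exponent for the gaps
    anywhere strictly between [1/4] and [1/2] would serve. *)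

(** * Absolutely convergent complex series *)

Definition CSeries (a : nat -> C) : C :=
  (Series (fun m => fst (a m)), Series (fun m => snd (a m))).

Definition ex_Cseries (a : nat -> C) : Prop := ex_series (fun m => Cmod (a m)).

Lemma Cmod_fst (z : C) : Rabs (fst z) <= Cmod z.
Proof. eapply Rle_trans; [apply Rmax_l | apply Rmax_Cmod]. Qed.

Lemma Cmod_snd (z : C) : Rabs (snd z) <= Cmod z.
Proof. eapply Rle_trans; [apply Rmax_r | apply Rmax_Cmod]. Qed.

Lemma ex_series_dominated (a b : nat -> R) :
  (forall m, Rabs (a m) <= b m) -> ex_series b -> ex_series a.
Proof. intros H Hb. apply (@ex_series_le R_AbsRing R_CompleteNormedModule a b); auto. Qed.

Lemma ex_Cseries_fst (a : nat -> C) : ex_Cseries a -> ex_series (fun m => fst (a m)).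
Proof. apply ex_series_dominated; intros; apply Cmod_fst. Qed.

Lemma ex_Cseries_snd (a : nat -> C) : ex_Cseries a -> ex_series (fun m => snd (a m)).
Proof. apply ex_series_dominated; intros; apply Cmod_snd. Qed.

Lemma ex_Cseries_dominated (a : nat -> C) (b : nat -> R) :
  (forall m, Cmod (a m) <= b m) -> ex_series b -> ex_Cseries a.
Proof.
  intros H. apply ex_series_dominated. intros m.
  rewrite Rabs_pos_eq by apply Cmod_ge_0. apply H.
Qed.

Lemma ex_Cseries_minus (a b : nat -> C) :
  ex_Cseries a -> ex_Cseries b -> ex_Cseries (fun m => a m - b m)%C.
Proof.
  intros Ha Hb. apply (ex_Cseries_dominated _ (fun m => Cmod (a m) + Cmod (b m))).
  - intros m. rewrite <- (Cmod_opp (b m)). apply Cmod_triangle.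
  - exact (ex_series_plus _ _ Ha Hb).
Qed.

Lemma ex_Cseries_scal (c : C) (a : nat -> C) :
  ex_Cseries a -> ex_Cseries (fun m => c * a m)%C.
Proof.
  intros Ha. apply (ex_Cseries_dominated _ (fun m => Cmod c * Cmod (a m))).
  - intros; rewrite Cmod_mult; lra.
  - exact (ex_series_scal_l (Cmod c) _ Ha).
Qed.

Lemma CSeries_ext (a b : nat -> C) : (forall m, a m = b m) -> CSeries a = CSeries b.
Proof. intros H; unfold CSeries; f_equal; apply Series_ext; intros; now rewrite H. Qed.

Lemma CSeries_plus (a b : nat -> C) : ex_Cseries a -> ex_Cseries b ->
  CSeries (fun m => a m + b m)%C = (CSeries a + CSeries b)%C.
Proof.
  intros Ha Hb. unfold CSeries, Cplus; simpl. f_equal.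
  - apply Series_plus; apply ex_Cseries_fst; assumption.
  - apply Series_plus; apply ex_Cseries_snd; assumption.
Qed.

Lemma CSeries_scal (c : C) (a : nat -> C) : ex_Cseries a ->
  CSeries (fun m => c * a m)%C = (c * CSeries a)%C.
Proof.
  intros Ha. unfold CSeries, Cmult; simpl.
  assert (H1 := ex_Cseries_fst _ Ha). assert (H2 := ex_Cseries_snd _ Ha).
  f_equal.
  - rewrite Series_minus.
    + now rewrite !Series_scal_l.
    + exact (ex_series_scal_l (fst c) _ H1).
    + exact (ex_series_scal_l (snd c) _ H2).
  - rewrite Series_plus.
    + now rewrite !Series_scal_l.
    + exact (ex_series_scal_l (fst c) _ H2).
    + exact (ex_series_scal_l (snd c) _ H1).
Qed.

Lemma CSeries_minus (a b : nat -> C) : ex_Cseries a -> ex_Cseries b ->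
  CSeries (fun m => a m - b m)%C = (CSeries a - CSeries b)%C.
Proof.
  intros Ha Hb.
  rewrite (CSeries_ext _ (fun m => a m + (- (1)) * b m)%C) by (intros; ring).
  rewrite CSeries_plus, CSeries_scal; auto using ex_Cseries_scal. ring.
Qed.

(** With [S] the sum, [|S|^2] is the inner product of [S] with itself; expand the
    second factor and apply the Cauchy-Schwarz inequality to each term. *)
Lemma Cmod_CSeries_le (a : nat -> C) : ex_Cseries a ->
  Cmod (CSeries a) <= Series (fun m => Cmod (a m)).
Proof.
  intros Ha. set (S := CSeries a).
  assert (H1 := ex_Cseries_fst _ Ha). assert (H2 := ex_Cseries_snd _ Ha).
  assert (HS : Cmod S ^ 2 <= Cmod S * Series (fun m => Cmod (a m))).
  { rewrite Cmod2_alt. unfold Re, Im.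
    replace (fst S ^ 2 + snd S ^ 2)
      with (Series (fun m => fst S * fst (a m) + snd S * snd (a m))).
    2:{ rewrite Series_plus.
        - rewrite !Series_scal_l. unfold S, CSeries; simpl. ring.
        - exact (ex_series_scal_l _ _ H1).
        - exact (ex_series_scal_l _ _ H2). }
    rewrite <- Series_scal_l.
    assert (Hterm : forall m, Rabs (fst S * fst (a m) + snd S * snd (a m)) <= Cmod S * Cmod (a m)).
    { intros m. apply Rsqr_incr_0_var.
      2:{ apply Rmult_le_pos; apply Cmod_ge_0. }
      rewrite <- Rsqr_abs, Rsqr_mult, !Rsqr_pow2, !Cmod2_alt. unfold Re, Im.
      assert (0 <= (fst S * snd (a m) - snd S * fst (a m)) ^ 2) by apply pow2_ge_0. nra. }
    eapply Rle_trans; [apply Rle_abs |].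
    eapply Rle_trans; [apply Series_Rabs |].
    - apply (ex_series_dominated _ (fun m => Cmod S * Cmod (a m))).
      + intros; rewrite Rabs_Rabsolu; apply Hterm.
      + exact (ex_series_scal_l _ _ Ha).
    - apply Series_le.
      + intros; split; [apply Rabs_pos | apply Hterm].
      + exact (ex_series_scal_l _ _ Ha). }
  assert (0 <= Cmod S) by apply Cmod_ge_0.
  assert (0 <= Series (fun m => Cmod (a m))).
  { rewrite <- (Rmult_0_l (Series (fun m : nat => Cmod (a m)))), <- Series_scal_l.
    apply Series_le; [intros m; assert (H0 := Cmod_ge_0 (a m)); lra | exact Ha]. }
  nra.
Qed.

Lemma is_series_single (k : nat) (c : R) :
  is_series (fun m => if Nat.eqb m k then c else 0) c.
Proof.
  change (is_lim_seq (sum_n (fun m => if Nat.eqb m k then c else 0)) c).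
  apply (is_lim_seq_ext_loc (fun _ => c)).
  2: apply is_lim_seq_const.
  exists k. intros N HN. induction HN as [|N HN IH].
  - assert (H : forall j, (j < k)%nat ->
        sum_n (fun m => if Nat.eqb m k then c else 0) j = 0).
    { induction j as [|j IHj]; intros Hj.
      - rewrite sum_O. destruct (Nat.eqb_spec 0 k); [lia | reflexivity].
      - rewrite sum_Sn, IHj by lia.
        destruct (Nat.eqb_spec (S j) k); [lia |]. apply Rplus_0_l. }
    destruct k as [|k].
    + rewrite sum_O. reflexivity.
    + rewrite sum_Sn, H, Nat.eqb_refl by lia. symmetry; apply Rplus_0_l.
  - rewrite sum_Sn, <- IH. destruct (Nat.eqb_spec (S N) k); [lia |].
    symmetry; apply Rplus_0_r.
Qed.

Lemma ex_Cseries_single (k : nat) (c : C) :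
  ex_Cseries (fun m => if Nat.eqb m k then c else RtoC 0).
Proof.
  exists (Cmod c). eapply is_series_ext; [|apply (is_series_single k)].
  intros m; simpl. destruct (Nat.eqb m k); [reflexivity | now rewrite Cmod_0].
Qed.

Lemma CSeries_single (k : nat) (c : C) :
  CSeries (fun m => if Nat.eqb m k then c else RtoC 0) = c.
Proof.
  destruct c as [c1 c2]. unfold CSeries.
  f_equal; apply is_series_unique; (eapply is_series_ext; [|apply (is_series_single k)]);
    intros m; simpl; destruct (Nat.eqb m k); reflexivity.
Qed.

Lemma is_series_telescope : is_series (fun m => / ((INR m + 1) * (INR m + 2))) 1.
Proof.
  change (is_lim_seq (sum_n (fun m => / ((INR m + 1) * (INR m + 2)))) 1).
  apply (is_lim_seq_ext (fun n => 1 - / (INR n + 2))).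
  - induction n as [|n IH].
    + rewrite sum_O. simpl. field.
    + rewrite sum_Sn, <- IH, S_INR. assert (0 <= INR n) by apply pos_INR.
      change plus with Rplus. field. lra.
  - replace (Finite 1) with (Rbar_minus 1 0) by (simpl; f_equal; ring).
    apply is_lim_seq_minus'; [apply is_lim_seq_const |].
    replace (Finite 0) with (Rbar_inv p_infty) by reflexivity.
    apply is_lim_seq_inv; [|discriminate].
    apply is_lim_seq_plus with p_infty 2; [apply is_lim_seq_INR | apply is_lim_seq_const | reflexivity].
Qed.

(** A termwise bound by a convergent numerical series turns a pointwise estimate
    into one for the sum, without choosing where to cut the series. *)
Lemma Cmod_CSeries_telescope (a : nat -> C) (eps : R) :
  (forall m, Cmod (a m) <= eps * / ((INR m + 1) * (INR m + 2))) ->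
  ex_Cseries a /\ Cmod (CSeries a) <= eps.
Proof.
  intros H.
  assert (HT : is_series (fun m => eps * / ((INR m + 1) * (INR m + 2))) eps).
  { assert (HT := is_series_scal eps _ _ is_series_telescope).
    change (scal eps 1) with (eps * 1) in HT. rewrite Rmult_1_r in HT. exact HT. }
  assert (Ha : ex_Cseries a) by (apply (ex_Cseries_dominated _ _ H); now exists eps).
  split; [exact Ha |].
  eapply Rle_trans; [apply Cmod_CSeries_le, Ha |].
  rewrite <- (is_series_unique _ _ HT). apply Series_le; [|now exists eps].
  intros m; split; [apply Cmod_ge_0 | apply H].
Qed.

(** * Everywhere convergent power series *)

Lemma Cpow_sub_le (x y : C) (r : R) (m : nat) :
  1 <= r -> Cmod x <= r -> Cmod y <= r ->
  Cmod (x ^ m - y ^ m)%C <= INR m * r ^ m * Cmod (x - y)%C.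
Proof.
  intros Hr Hx Hy. assert (Hd := Cmod_ge_0 (x - y)%C).
  induction m as [|m IH].
  - simpl. replace (1 - 1)%C with (RtoC 0) by ring. rewrite Cmod_0. lra.
  - replace (x ^ S m - y ^ S m)%C with (x * (x ^ m - y ^ m) + (x - y) * y ^ m)%C
      by (simpl; ring).
    eapply Rle_trans; [apply Cmod_triangle |]. rewrite !Cmod_mult, Cmod_pow, S_INR.
    assert (Hy' : Cmod y ^ m <= r ^ m) by (apply pow_incr; split; [apply Cmod_ge_0 | exact Hy]).
    assert (0 <= r ^ m) by (apply pow_le; lra).
    assert (0 <= INR m) by apply pos_INR.
    assert (Cmod x * Cmod (x ^ m - y ^ m)%C <= r * (INR m * r ^ m * Cmod (x - y)%C))
      by (apply Rmult_le_compat; auto using Cmod_ge_0).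
    assert (Cmod (x - y)%C * Cmod y ^ m <= Cmod (x - y)%C * (r * r ^ m))
      by (apply Rmult_le_compat_l; nra).
    simpl. lra.
Qed.

Lemma Cpow_taylor_le (z w : C) (r : R) (m : nat) :
  1 <= r -> Cmod z <= r -> Cmod w <= r ->
  Cmod (w ^ m - z ^ m - (w - z) * (INR m * z ^ pred m))%C
    <= INR m ^ 2 * r ^ m * Cmod (w - z)%C ^ 2.
Proof.
  intros Hr Hz Hw. assert (Hd := Cmod_ge_0 (w - z)%C).
  induction m as [|m IH].
  - simpl. replace (1 - 1 - (w - z) * (0 * 1))%C with (RtoC 0) by ring. rewrite Cmod_0. lra.
  - replace (w ^ S m - z ^ S m - (w - z) * (INR (S m) * z ^ pred (S m)))%C
      with (w * (w ^ m - z ^ m - (w - z) * (INR m * z ^ pred m))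
            + INR m * ((w - z) * ((w - z) * z ^ pred m)))%C.
    2:{ rewrite S_INR, RtoC_plus. simpl pred.
        destruct m as [|m]; simpl; ring. }
    eapply Rle_trans; [apply Cmod_triangle |]. rewrite !Cmod_mult, Cmod_pow, Cmod_R.
    assert (0 <= INR m) by apply pos_INR. rewrite (Rabs_pos_eq (INR m)) by assumption.
    assert (Hz' : Cmod z ^ pred m <= r ^ S m).
    { eapply Rle_trans with (r ^ pred m).
      - apply pow_incr; split; [apply Cmod_ge_0 | exact Hz].
      - apply Rle_pow; [exact Hr | lia]. }
    assert (0 <= r ^ m) by (apply pow_le; lra).
    set (D := Cmod (w - z)%C) in *.
    assert (Cmod w * Cmod (w ^ m - z ^ m - (w - z) * (INR m * z ^ pred m))%C
            <= r * (INR m ^ 2 * r ^ m * D ^ 2))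
      by (apply Rmult_le_compat; auto using Cmod_ge_0).
    assert (INR m * (D * (D * Cmod z ^ pred m)) <= INR m * (D * (D * r ^ S m)))
      by (repeat (apply Rmult_le_compat_l; [assumption |]); assumption).
    rewrite S_INR. replace (r ^ S m) with (r * r ^ m) in * by reflexivity.
    assert (0 <= r * r ^ m * D ^ 2 * (INR m + 1)).
    { repeat apply Rmult_le_pos; try lra; apply pow2_ge_0. }
    nra.
Qed.

Definition entire_coef (a : nat -> R) : Prop :=
  forall r : R, 0 <= r -> ex_series (fun m => Rabs (a m) * r ^ m).

Definition CPS (a : nat -> R) (z : C) : C := CSeries (fun m => a m * z ^ m)%C.

Lemma ex_CPS (a : nat -> R) (z : C) : entire_coef a -> ex_Cseries (fun m => a m * z ^ m)%C.
Proof.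
  intros Ha. eapply ex_Cseries_dominated; [|apply (Ha (Cmod z)), Cmod_ge_0].
  intros m. rewrite Cmod_mult, Cmod_pow, Cmod_R. apply Rle_refl.
Qed.

Lemma INR_le_pow2 (m : nat) : INR m + 1 <= 2 ^ m.
Proof.
  induction m as [|m IH]; [simpl; lra |].
  rewrite S_INR. simpl. assert (0 <= INR m) by apply pos_INR. lra.
Qed.

Lemma entire_coef_sqr (a : nat -> R) : entire_coef a ->
  forall r, 0 <= r -> ex_series (fun m => Rabs (a m) * (INR m ^ 2 * r ^ m)).
Proof.
  intros Ha r Hr. apply (ex_series_dominated _ (fun m => Rabs (a m) * (4 * r) ^ m)).
  2: apply Ha; lra.
  intros m.
  assert (H0 : 0 <= INR m) by apply pos_INR.
  assert (H1 := INR_le_pow2 m). assert (Hp : 0 <= r ^ m) by (apply pow_le; lra).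
  rewrite Rabs_pos_eq.
  2:{ apply Rmult_le_pos; [apply Rabs_pos |]. apply Rmult_le_pos; [apply pow2_ge_0 | exact Hp]. }
  apply Rmult_le_compat_l; [apply Rabs_pos |].
  rewrite Rpow_mult_distr. apply Rmult_le_compat_r; [exact Hp |].
  replace 4 with (2 ^ 2) by ring. rewrite <- pow_mult, Nat.mul_comm, pow_mult.
  apply pow_incr. lra.
Qed.

Definition deriv_coef (a : nat -> R) (m : nat) : R := INR (S m) * a (S m).

Lemma entire_coef_deriv (a : nat -> R) : entire_coef a -> entire_coef (deriv_coef a).
Proof.
  intros Ha r Hr.
  assert (Hex : ex_series (fun m => Rabs (a (S m)) * (INR (S m) ^ 2 * (r + 1) ^ S m))).
  { apply (ex_series_incr_1 (fun m => Rabs (a m) * (INR m ^ 2 * (r + 1) ^ m))).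
    apply entire_coef_sqr; [exact Ha | lra]. }
  revert Hex. apply ex_series_dominated. intros m.
  assert (H1 : 1 <= INR (S m)) by (rewrite S_INR; assert (H := pos_INR m); lra).
  assert (0 <= Rabs (a (S m))) by apply Rabs_pos.
  assert (0 <= r ^ m) by (apply pow_le; exact Hr).
  assert (r ^ m <= (r + 1) ^ S m).
  { apply Rle_trans with ((r + 1) ^ m); [apply pow_incr; lra | apply Rle_pow; [lra | lia]]. }
  unfold deriv_coef.
  rewrite Rabs_mult, (Rabs_pos_eq (r ^ m)), Rabs_Rabsolu, Rabs_mult, (Rabs_pos_eq (INR (S m))) by lra.
  replace (INR (S m) * Rabs (a (S m)) * r ^ m) with (Rabs (a (S m)) * (INR (S m) * r ^ m)) by ring.
  apply Rmult_le_compat_l; [assumption |].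
  apply Rmult_le_compat; try lra. nra.
Qed.

Lemma CPS_deriv_eq (a : nat -> R) (z : C) :
  CPS (deriv_coef a) z = CSeries (fun m => a m * (INR m * z ^ pred m))%C.
Proof.
  unfold CPS, CSeries. f_equal.
  - rewrite (Series_incr_1_aux (fun m => fst (a m * (INR m * z ^ pred m))%C)) by (simpl; ring).
    apply Series_ext; intros m. unfold deriv_coef. rewrite RtoC_mult.
    f_equal. simpl pred. ring.
  - rewrite (Series_incr_1_aux (fun m => snd (a m * (INR m * z ^ pred m))%C)) by (simpl; ring).
    apply Series_ext; intros m. unfold deriv_coef. rewrite RtoC_mult.
    f_equal. simpl pred. ring.
Qed.

Lemma ex_Cseries_deriv_terms (a : nat -> R) (z : C) : entire_coef a ->
  ex_Cseries (fun m => a m * (INR m * z ^ pred m))%C.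
Proof.
  intros Ha. assert (Hz := Cmod_ge_0 z).
  apply (ex_Cseries_dominated _ (fun m => Rabs (a m) * (INR m ^ 2 * (Cmod z + 1) ^ m))).
  2: apply entire_coef_sqr; [exact Ha | lra].
  intros m. rewrite !Cmod_mult, Cmod_pow, !Cmod_R, (Rabs_pos_eq (INR m)) by apply pos_INR.
  apply Rmult_le_compat_l; [apply Rabs_pos |].
  destruct m as [|m]; [simpl; lra |].
  assert (1 <= INR (S m)) by (rewrite S_INR; assert (H := pos_INR m); lra).
  assert (0 <= Cmod z ^ pred (S m)) by (apply pow_le; exact Hz).
  assert (Cmod z ^ pred (S m) <= (Cmod z + 1) ^ S m).
  { apply Rle_trans with ((Cmod z + 1) ^ pred (S m));
      [apply pow_incr; lra | apply Rle_pow; [lra | lia]]. }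
  apply Rmult_le_compat; try lra. nra.
Qed.

(** On the unit disc around [z] the error of the termwise linear approximation is
    at most [K |w - z|^2]. *)
Lemma is_derive_CPS (a : nat -> R) (z : C) : entire_coef a ->
  @is_derive C_AbsRing C_NormedModule (CPS a) z (CPS (deriv_coef a) z).
Proof.
  intros Ha. set (r := Cmod z + 1). assert (Hz := Cmod_ge_0 z).
  set (K := Series (fun m => Rabs (a m) * (INR m ^ 2 * r ^ m))).
  assert (HK : ex_series (fun m => Rabs (a m) * (INR m ^ 2 * r ^ m)))
    by (apply entire_coef_sqr; [exact Ha | unfold r; lra]).
  assert (Hquad : forall w, Cmod (w - z)%C <= 1 ->
      Cmod (CPS a w - CPS a z - (w - z) * CPS (deriv_coef a) z)%C <= K * Cmod (w - z)%C ^ 2).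
  { intros w Hw.
    assert (Hwr : Cmod w <= r).
    { replace w with (z + (w - z))%C by ring. eapply Rle_trans; [apply Cmod_triangle |].
      unfold r; lra. }
    set (t := fun m => (a m * (w ^ m - z ^ m - (w - z) * (INR m * z ^ pred m)))%C).
    assert (Ht : forall m, Cmod (t m) <= Cmod (w - z)%C ^ 2 * (Rabs (a m) * (INR m ^ 2 * r ^ m))).
    { intros m. unfold t. rewrite Cmod_mult, Cmod_R.
      assert (H := Cpow_taylor_le z w r m ltac:(unfold r; lra) ltac:(unfold r; lra) Hwr).
      assert (H' := Rmult_le_compat_l _ _ _ (Rabs_pos (a m)) H). lra. }
    assert (Hext : ex_Cseries t).
    { apply (ex_Cseries_dominated _ _ Ht). exact (ex_series_scal_l (Cmod (w - z)%C ^ 2) _ HK). }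
    replace (CPS a w - CPS a z - (w - z) * CPS (deriv_coef a) z)%C with (CSeries t).
    - eapply Rle_trans; [apply Cmod_CSeries_le, Hext |].
      rewrite Rmult_comm. unfold K. rewrite <- Series_scal_l.
      apply Series_le.
      + intros m; split; [apply Cmod_ge_0 | apply Ht].
      + exact (ex_series_scal_l (Cmod (w - z)%C ^ 2) _ HK).
    - rewrite CPS_deriv_eq, <- CSeries_scal by (apply ex_Cseries_deriv_terms; exact Ha).
      unfold CPS. rewrite <- !CSeries_minus;
        auto using ex_Cseries_minus, ex_Cseries_scal, ex_CPS, ex_Cseries_deriv_terms.
      apply CSeries_ext; intros m; unfold t; ring. }
  assert (HK0 : 0 <= K).
  { assert (H := Hquad (z + 1)%C). replace (z + 1 - z)%C with (RtoC 1) in H by ring.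
    rewrite Cmod_1 in H. specialize (H ltac:(lra)).
    assert (H' := Cmod_ge_0 (CPS a (z + 1) - CPS a z - 1 * CPS (deriv_coef a) z)%C). lra. }
  split; [apply is_linear_scal_l |].
  intros x Hx eps. apply (@is_filter_lim_locally_unique C_AbsRing (AbsRing_NormedModule C_AbsRing)) in Hx.
  subst x. apply (@locally_le_locally_norm C_AbsRing (AbsRing_NormedModule C_AbsRing)).
  assert (Hd : 0 < Rmin 1 (eps / (K + 1))).
  { apply Rmin_pos; [lra | apply Rdiv_lt_0_compat; [apply eps | lra]]. }
  exists (mkposreal _ Hd). intros w Hw.
  change (Cmod (w - z)%C < Rmin 1 (eps / (K + 1))) in Hw.
  change (Cmod (CPS a w - CPS a z - (w - z) * CPS (deriv_coef a) z)%C <= eps * Cmod (w - z)%C).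
  assert (H1 : Cmod (w - z)%C < 1) by (eapply Rlt_le_trans; [apply Hw | apply Rmin_l]).
  assert (H2 : Cmod (w - z)%C < eps / (K + 1)) by (eapply Rlt_le_trans; [apply Hw | apply Rmin_r]).
  eapply Rle_trans; [apply Hquad; lra |].
  assert (Hd0 := Cmod_ge_0 (w - z)%C).
  apply Rlt_div_r in H2; [|lra].
  replace (K * Cmod (w - z)%C ^ 2) with (K * Cmod (w - z)%C * Cmod (w - z)%C) by ring.
  apply Rmult_le_compat_r; [exact Hd0 | nra].
Qed.

(** The Taylor coefficients at zero of the [n]-th derivative of [CPS a]. *)
Definition shift_coef (n : nat) (a : nat -> R) (m : nat) : R :=
  a (n + m)%nat * INR (fact (n + m)) / INR (fact m).

Lemma deriv_shift_coef (n : nat) (a : nat -> R) (m : nat) :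
  deriv_coef (shift_coef n a) m = shift_coef (S n) a m.
Proof.
  unfold deriv_coef, shift_coef. replace (S n + m)%nat with (n + S m)%nat by lia.
  rewrite (fact_simpl m), mult_INR. field.
  split; [apply INR_fact_neq_0 | apply not_0_INR; lia].
Qed.

Lemma CPS_ext (a b : nat -> R) (z : C) : (forall m, a m = b m) -> CPS a z = CPS b z.
Proof. intros H; apply CSeries_ext; intros m; now rewrite H. Qed.

Lemma entire_coef_ext (a b : nat -> R) :
  (forall m, a m = b m) -> entire_coef a -> entire_coef b.
Proof.
  intros H Ha r Hr. eapply ex_series_ext; [|apply (Ha r Hr)].
  intros m; simpl; now rewrite H.
Qed.

Lemma entire_coef_shift (n : nat) (a : nat -> R) : entire_coef a -> entire_coef (shift_coef n a).
Proof.
  intros Ha. induction n as [|n IH].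
  - apply (entire_coef_ext a); [|exact Ha].
    intros m. unfold shift_coef. simpl. field. apply INR_fact_neq_0.
  - apply (entire_coef_ext (deriv_coef (shift_coef n a))); [apply deriv_shift_coef |].
    apply entire_coef_deriv, IH.
Qed.

Lemma C_derive_n_CPS (a : nat -> R) (n : nat) (z : C) : entire_coef a ->
  C_derive_n (CPS a) n z = CPS (shift_coef n a) z.
Proof.
  intros Ha. revert z. induction n as [|n IH]; intros z.
  - apply CPS_ext. intros m. unfold shift_coef. simpl. field. apply INR_fact_neq_0.
  - change (C_derive (C_derive_n (CPS a) n) z = CPS (shift_coef (S n) a) z).
    apply is_C_derive_unique.
    rewrite <- (CPS_ext _ _ z (deriv_shift_coef n a)).
    apply (is_derive_ext (CPS (shift_coef n a))); [intros; symmetry; apply IH |].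
    apply is_derive_CPS, entire_coef_shift, Ha.
Qed.

(** * A zero where two terms of a power series cancel *)

Lemma Cmod_le_sum (z : C) : Cmod z <= Rabs (fst z) + Rabs (snd z).
Proof.
  apply Rsqr_incr_0_var.
  2:{ apply Rplus_le_le_0_compat; apply Rabs_pos. }
  rewrite !Rsqr_pow2, Cmod2_alt. unfold Re, Im.
  assert (H1 := Rabs_pos (fst z)). assert (H2 := Rabs_pos (snd z)).
  rewrite <- (pow2_abs (fst z)), <- (pow2_abs (snd z)). nra.
Qed.

(** The factor one half and the bound on [T 0] together make [T] map the disc into itself. *)
Lemma contraction_fixed_point (T : C -> C) (tau : R) :
  0 < tau ->
  (forall u v, Cmod u <= tau -> Cmod v <= tau -> Cmod (T u - T v)%C <= / 2 * Cmod (u - v)%C) ->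
  Cmod (T 0) <= tau / 2 ->
  exists u, Cmod u <= tau /\ T u = u.
Proof.
  intros Htau HT H0.
  set (x := fun n => Nat.iter n T (RtoC 0)). set (d := fun n => (x (S n) - x n)%C).
  assert (Hx : forall n, Cmod (x n) <= tau * (1 - (/ 2) ^ n) /\ Cmod (d n) <= tau / 2 * (/ 2) ^ n).
  { induction n as [|n [IH1 IH2]].
    - unfold d, x; simpl. rewrite Cmod_0. replace (T 0 - 0)%C with (T 0) by ring. lra.
    - assert (Hp : 0 < (/ 2) ^ n) by (apply pow_lt; lra).
      assert (Hb : Cmod (x (S n)) <= tau * (1 - (/ 2) ^ S n)).
      { replace (x (S n)) with (x n + d n)%C by (unfold d; ring).
        eapply Rle_trans; [apply Cmod_triangle |]. rewrite <- tech_pow_Rmult. lra. }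
      split; [exact Hb |]. rewrite <- tech_pow_Rmult in Hb |- *.
      assert (Hs := HT (x (S n)) (x n)).
      change (T (x (S n)) - T (x n))%C with (d (S n)) in Hs. fold (d n) in Hs.
      specialize (Hs ltac:(nra) ltac:(nra)). lra. }
  assert (Hd : ex_Cseries d).
  { apply (ex_Cseries_dominated _ (fun n => tau / 2 * (/ 2) ^ n)); [intros; apply Hx |].
    apply (ex_series_scal_l (tau / 2) (fun n => (/ 2) ^ n)).
    exists (/ (1 - / 2)). apply is_series_geom. rewrite Rabs_pos_eq; lra. }
  set (u := CSeries d).
  assert (Hf : is_lim_seq (fun n => fst (x (S n))) (fst u)).
  { apply (is_lim_seq_ext (sum_n (fun m => fst (d m)))).
    - induction n as [|n IH].
      + rewrite sum_O. unfold d; simpl; ring.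
      + rewrite sum_Sn, IH. change plus with Rplus. unfold d at 1. simpl; ring.
    - exact (Series_correct _ (ex_Cseries_fst _ Hd)). }
  assert (Hs : is_lim_seq (fun n => snd (x (S n))) (snd u)).
  { apply (is_lim_seq_ext (sum_n (fun m => snd (d m)))).
    - induction n as [|n IH].
      + rewrite sum_O. unfold d; simpl; ring.
      + rewrite sum_Sn, IH. change plus with Rplus. unfold d at 1. simpl; ring.
    - exact (Series_correct _ (ex_Cseries_snd _ Hd)). }
  assert (He : forall eps : posreal, exists N, forall n, (N <= n)%nat -> Cmod (x (S n) - u)%C < eps).
  { intros eps. apply is_lim_seq_spec in Hf. apply is_lim_seq_spec in Hs.
    destruct (Hf (pos_div_2 eps)) as [N1 HN1]. destruct (Hs (pos_div_2 eps)) as [N2 HN2].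
    exists (N1 + N2)%nat. intros n Hn.
    specialize (HN1 n ltac:(lia)). specialize (HN2 n ltac:(lia)). simpl in HN1, HN2.
    eapply Rle_lt_trans; [apply Cmod_le_sum |]. simpl.
    unfold Rminus in HN1, HN2. lra. }
  assert (Hu : Cmod u <= tau).
  { apply le_epsilon. intros eps Heps. destruct (He (mkposreal _ Heps)) as [N HN].
    specialize (HN N (le_n _)). change (Cmod (x (S N) - u)%C < eps) in HN.
    replace u with (x (S N) + - (x (S N) - u))%C by ring.
    eapply Rle_trans; [apply Cmod_triangle |]. rewrite Cmod_opp.
    assert (Hp : 0 < (/ 2) ^ S N) by (apply pow_lt; lra).
    destruct (Hx (S N)) as [Hb _]. nra. }
  exists u. split; [exact Hu |].
  assert (Hz : Cmod (T u - u)%C <= 0).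
  { apply le_epsilon. intros eps Heps.
    destruct (He (pos_div_2 (mkposreal _ Heps))) as [N HN].
    assert (HN1 := HN N (le_n _)). assert (HN2 := HN (S N) ltac:(lia)).
    change (Cmod (x (S N) - u)%C < eps / 2) in HN1.
    change (Cmod (x (S (S N)) - u)%C < eps / 2) in HN2.
    replace (T u - u)%C with ((x (S (S N)) - u) + - (T (x (S N)) - T u))%C
      by (change (x (S (S N))) with (T (x (S N))); ring).
    eapply Rle_trans; [apply Cmod_triangle |]. rewrite Cmod_opp.
    assert (Hp : 0 < (/ 2) ^ S N) by (apply pow_lt; lra).
    destruct (Hx (S N)) as [Hb _].
    specialize (HT (x (S N)) u ltac:(nra) Hu).
    change (x (S (S N))) with (T (x (S N))) in *. lra. }
  replace u with (u + 0)%C at 2 by ring.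
  rewrite <- (Cmod_eq_0 (T u - u)%C); [ring |].
  assert (H := Cmod_ge_0 (T u - u)%C). lra.
Qed.

Lemma Cpow_near_one_diff (u v : C) (tau : R) (k : nat) :
  Cmod u <= tau -> Cmod v <= tau ->
  Cmod ((1 + u) ^ k - (1 + v) ^ k - INR k * (u - v))%C
    <= 2 * INR k ^ 2 * tau * (1 + tau) ^ k * Cmod (u - v)%C.
Proof.
  intros Hu Hv.
  assert (Htau : 0 <= tau) by (eapply Rle_trans; [apply Cmod_ge_0 | apply Hu]).
  assert (Hmod : forall w, Cmod w <= tau -> Cmod (1 + w)%C <= 1 + tau).
  { intros w Hw. eapply Rle_trans; [apply Cmod_triangle |]. rewrite Cmod_1. lra. }
  assert (Hd := Cmod_ge_0 (u - v)%C).
  induction k as [|k IH].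
  - simpl. replace (1 - 1 - 0 * (u - v))%C with (RtoC 0) by ring. rewrite Cmod_0. lra.
  - replace ((1 + u) ^ S k - (1 + v) ^ S k - INR (S k) * (u - v))%C
      with (((1 + u) ^ k - (1 + v) ^ k - INR k * (u - v)) +
            (u * ((1 + u) ^ k - (1 + v) ^ k) + (u - v) * ((1 + v) ^ k - 1 ^ k)))%C.
    2:{ rewrite S_INR, RtoC_plus, Cpow_1_l. simpl. ring. }
    eapply Rle_trans; [apply Cmod_triangle |].
    assert (Hk : 0 <= INR k) by apply pos_INR.
    set (P := (1 + tau) ^ k) in *.
    assert (HP : 0 <= P) by (apply pow_le; lra).
    assert (H1 : Cmod (u * ((1 + u) ^ k - (1 + v) ^ k))%C <= tau * (INR k * P * Cmod (u - v)%C)).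
    { rewrite Cmod_mult. apply Rmult_le_compat; auto using Cmod_ge_0.
      replace (u - v)%C with (1 + u - (1 + v))%C by ring.
      apply Cpow_sub_le; [lra | apply Hmod, Hu | apply Hmod, Hv]. }
    assert (H2 : Cmod ((u - v) * ((1 + v) ^ k - 1 ^ k))%C <= Cmod (u - v)%C * (INR k * P * tau)).
    { rewrite Cmod_mult. apply Rmult_le_compat_l; [exact Hd |].
      eapply Rle_trans; [apply (Cpow_sub_le (1 + v)%C 1 (1 + tau))|].
      - lra.
      - apply Hmod, Hv.
      - rewrite Cmod_1; lra.
      - apply Rmult_le_compat_l; [apply Rmult_le_pos; assumption |].
        replace (1 + v - 1)%C with v by ring. exact Hv. }
    assert (H3 := Cmod_triangle (u * ((1 + u) ^ k - (1 + v) ^ k))%C ((u - v) * ((1 + v) ^ k - 1 ^ k))%C).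
    rewrite S_INR. simpl pow. fold P.
    set (D := Cmod (u - v)%C) in *. clearbody P D.
    assert (0 <= tau * P * D) by (repeat apply Rmult_le_pos; assumption).
    assert (0 <= tau * P * D * (INR k + 1)) by (apply Rmult_le_pos; lra).
    assert (0 <= tau * P * D * (INR k + 1) ^ 2 * tau) by (repeat apply Rmult_le_pos; try lra; apply pow2_ge_0).
    nra.
Qed.

Lemma exp_le_two (x : R) : x <= / 2 -> exp x <= 2.
Proof.
  intros Hx. assert (H := exp_ineq1_le (- x)). rewrite exp_Ropp in H.
  assert (Hp := exp_pos x).
  apply (Rmult_le_compat_r (exp x)) in H; [|lra]. rewrite Rinv_l in H by lra. nra.
Qed.

Lemma exp_pow (x : R) (n : nat) : exp x ^ n = exp (INR n * x).
Proof.
  induction n as [|n IH]; [simpl; now rewrite Rmult_0_l, exp_0 |].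
  rewrite <- tech_pow_Rmult, IH, <- exp_plus, S_INR. f_equal. ring.
Qed.

Lemma one_plus_pow_le_exp (t : R) (m : nat) : 0 <= t -> (1 + t) ^ m <= exp (t * INR m).
Proof.
  intros Ht. rewrite Rmult_comm, <- exp_pow.
  apply pow_incr. split; [lra | apply exp_ineq1_le].
Qed.

(** The model [(1 + u)^k0 - (1 + u)^k1] vanishes at [u = 0] with derivative [k0 - k1],
    and on [|u| <= 1 / (32 k1^2)] its derivative barely moves.  If the remaining terms are
    tiny there, the simplified Newton map [u + F u / (k1 - k0)] is a
    contraction, and its fixed point is a zero of [F]. *)
Lemma two_term_zero (p : nat -> C) (k0 k1 : nat) (eps : R) :
  (k0 < k1)%nat -> p k0 = RtoC 1 -> p k1 = (- (1))%C ->
  eps <= / (64 * INR k1 ^ 2) ->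
  (forall m, m <> k0 -> m <> k1 ->
     Cmod (p m) * ((INR m + 1) * (1 + / (32 * INR k1 ^ 2)) ^ m) * ((INR m + 1) * (INR m + 2)) <= eps) ->
  exists u, Cmod u <= / (32 * INR k1 ^ 2) /\ CSeries (fun m => p m * (1 + u) ^ m)%C = RtoC 0.
Proof.
  intros Hk Hp0 Hp1 Heps Hp.
  remember (/ (32 * INR k1 ^ 2)) as tau eqn:Etau.
  assert (Hk1 : 1 <= INR k1) by (change 1 with (INR 1); apply le_INR; lia).
  assert (Hk01 : INR k0 + 1 <= INR k1) by (rewrite <- S_INR; apply le_INR; lia).
  assert (Hk0 := pos_INR k0).
  assert (Htau : 0 < tau) by (rewrite Etau; apply Rinv_0_lt_compat; nra).
  assert (Htk : tau * INR k1 ^ 2 = / 32) by (rewrite Etau; field; lra).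
  assert (Heps2 : eps <= tau / 2).
  { replace (tau / 2) with (/ (64 * INR k1 ^ 2)) by (rewrite Etau; field; lra). exact Heps. }
  assert (Hk1' : 1 <= INR k1 ^ 2) by (apply pow_R1_Rle; exact Hk1).
  assert (Htau1 : tau <= / 32).
  { rewrite <- Htk, <- (Rmult_1_r tau) at 1. apply Rmult_le_compat_l; lra. }
  set (e := fun m => if Nat.eqb m k0 then RtoC 0 else if Nat.eqb m k1 then RtoC 0 else p m).
  assert (He : forall m, Cmod (e m) * ((INR m + 1) * (1 + tau) ^ m)
                         <= eps * / ((INR m + 1) * (INR m + 2))).
  { intros m. assert (Hm := pos_INR m).
    apply Rmult_le_reg_r with ((INR m + 1) * (INR m + 2)); [nra |].
    rewrite (Rmult_assoc eps), Rinv_l, Rmult_1_r by nra.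
    assert (Heps0 : 0 <= eps).
    { specialize (Hp (S (k0 + k1)) ltac:(lia) ltac:(lia)).
      eapply Rle_trans; [|apply Hp].
      assert (0 <= INR (S (k0 + k1))) by apply pos_INR.
      repeat apply Rmult_le_pos; try lra; try apply Cmod_ge_0. apply pow_le; lra. }
    unfold e. destruct (Nat.eqb_spec m k0); [rewrite Cmod_0; lra |].
    destruct (Nat.eqb_spec m k1); [rewrite Cmod_0; lra |]. apply Hp; assumption. }
  set (E := fun u => CSeries (fun m => e m * (1 + u) ^ m)%C).
  assert (Hmod : forall w, Cmod w <= tau -> Cmod (1 + w)%C <= 1 + tau).
  { intros w Hw. eapply Rle_trans; [apply Cmod_triangle |]. rewrite Cmod_1. lra. }
  assert (HE : forall u, Cmod u <= tau ->
      ex_Cseries (fun m => e m * (1 + u) ^ m)%C /\ Cmod (E u) <= eps).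
  { intros u Hu. apply Cmod_CSeries_telescope. intros m.
    eapply Rle_trans; [|apply He]. rewrite Cmod_mult, Cmod_pow.
    apply Rmult_le_compat_l; [apply Cmod_ge_0 |].
    assert (Hpw : Cmod (1 + u)%C ^ m <= (1 + tau) ^ m)
      by (apply pow_incr; split; [apply Cmod_ge_0 | apply Hmod, Hu]).
    assert (Hm := pos_INR m). assert (0 <= (1 + tau) ^ m) by (apply pow_le; lra). nra. }
  assert (HEd : forall u v, Cmod u <= tau -> Cmod v <= tau ->
      Cmod (E u - E v)%C <= eps * Cmod (u - v)%C).
  { intros u v Hu Hv. unfold E.
    rewrite <- CSeries_minus by (apply HE; assumption).
    apply Cmod_CSeries_telescope. intros m.
    replace (e m * (1 + u) ^ m - e m * (1 + v) ^ m)%C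
      with (e m * ((1 + u) ^ m - (1 + v) ^ m))%C by ring.
    rewrite Cmod_mult. assert (Hm := pos_INR m). assert (Hd := Cmod_ge_0 (u - v)%C).
    assert (Hl := Cpow_sub_le (1 + u)%C (1 + v)%C (1 + tau) m ltac:(lra) (Hmod _ Hu) (Hmod _ Hv)).
    replace (1 + u - (1 + v))%C with (u - v)%C in Hl by ring.
    apply Rle_trans with (Cmod (e m) * ((INR m + 1) * (1 + tau) ^ m) * Cmod (u - v)%C).
    - rewrite Rmult_assoc. apply Rmult_le_compat_l; [apply Cmod_ge_0 |].
      assert (0 <= (1 + tau) ^ m * Cmod (u - v)%C)
        by (apply Rmult_le_pos; [apply pow_le; lra | exact Hd]). nra.
    - specialize (He m). apply (Rmult_le_compat_r _ _ _ Hd) in He. lra. }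
  set (F := fun u => ((1 + u) ^ k0 - (1 + u) ^ k1 + E u)%C).
  assert (HF : forall u, Cmod u <= tau -> CSeries (fun m => p m * (1 + u) ^ m)%C = F u).
  { intros u Hu. unfold F, E.
    rewrite <- (CSeries_single k0 ((1 + u) ^ k0)%C), <- (CSeries_single k1 ((1 + u) ^ k1)%C).
    rewrite <- CSeries_minus by apply ex_Cseries_single.
    rewrite <- CSeries_plus;
      [| apply ex_Cseries_minus; apply ex_Cseries_single | apply HE, Hu].
    apply CSeries_ext. intros m. unfold e.
    destruct (Nat.eqb_spec m k0) as [->|].
    - destruct (Nat.eqb_spec k0 k1); [lia |]. rewrite Hp0. ring.
    - destruct (Nat.eqb_spec m k1) as [->|]; [rewrite Hp1|]; ring. }
  set (G := INR k1 - INR k0). assert (HG : 1 <= G) by (unfold G; lra).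
  assert (HGC : RtoC G <> RtoC 0) by (intros H; apply RtoC_inj in H; lra).
  destruct (contraction_fixed_point (fun u => u + F u / G)%C tau Htau) as [u [Hu Hfix]].
  - intros u v Hu Hv.
    assert (Hpk : forall k, (k <= k1)%nat ->
        Cmod ((1 + u) ^ k - (1 + v) ^ k - INR k * (u - v))%C <= / 8 * Cmod (u - v)%C).
    { intros k Hkk. eapply Rle_trans; [apply (Cpow_near_one_diff u v tau k Hu Hv) |].
      apply Rmult_le_compat_r; [apply Cmod_ge_0 |].
      assert (Hkr : INR k <= INR k1) by (apply le_INR; exact Hkk).
      assert (Hk' := pos_INR k).
      assert (Hexp : (1 + tau) ^ k <= 2).
      { eapply Rle_trans; [apply one_plus_pow_le_exp; lra |]. apply exp_le_two. nra. }
      assert (0 <= (1 + tau) ^ k) by (apply pow_le; lra).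
      assert (INR k ^ 2 * tau <= / 32) by nra.
      assert (0 <= INR k ^ 2 * tau) by (apply Rmult_le_pos; [apply pow2_ge_0 | lra]).
      nra. }
    replace (u + F u / G - (v + F v / G))%C with
      ((((1 + u) ^ k0 - (1 + v) ^ k0 - INR k0 * (u - v))
        - ((1 + u) ^ k1 - (1 + v) ^ k1 - INR k1 * (u - v)) + (E u - E v)) / G)%C.
    2:{ unfold F, G in *. rewrite RtoC_minus in *. field. exact HGC. }
    rewrite Cmod_div, Cmod_R, Rabs_pos_eq by (lra || exact HGC).
    apply Rle_div_l; [lra |].
    assert (H0 := Hpk k0 ltac:(lia)). assert (H1 := Hpk k1 ltac:(lia)).
    assert (HE' := HEd u v Hu Hv). assert (Hd := Cmod_ge_0 (u - v)%C).
    set (A := ((1 + u) ^ k0 - (1 + v) ^ k0 - INR k0 * (u - v))%C) in *.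
    set (B := ((1 + u) ^ k1 - (1 + v) ^ k1 - INR k1 * (u - v))%C) in *.
    assert (Ht1 := Cmod_triangle (A - B)%C (E u - E v)%C).
    assert (Ht2 := Cmod_triangle A (- B)%C). rewrite Cmod_opp in Ht2.
    change (A + - B)%C with (A - B)%C in Ht2. nra.
  - replace (0 + F 0 / G)%C with (E 0 / G)%C.
    2:{ unfold F. replace (1 + 0)%C with (RtoC 1) by ring. rewrite !Cpow_1_l.
        field. exact HGC. }
    rewrite Cmod_div, Cmod_R, Rabs_pos_eq by (lra || exact HGC).
    apply Rle_div_l; [lra |].
    destruct (HE 0) as [_ H]; [rewrite Cmod_0; lra |]. nra.
  - exists u. split; [exact Hu |]. rewrite HF by exact Hu.
    cbv beta in Hfix.
    replace (F u) with ((u + F u / G - u) * G)%C by (field; exact HGC).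
    rewrite Hfix. ring.
Qed.

(** * Decay away from two equal terms of a log-concave sequence *)

Lemma exp_le_compat (x y : R) : x <= y -> exp x <= exp y.
Proof. intros [H | ->]; [left; now apply exp_increasing | lra]. Qed.

Lemma pow_lt_compat (x y : R) (g : nat) : 0 <= x < y -> (1 <= g)%nat -> x ^ g < y ^ g.
Proof.
  intros Hxy Hg. induction Hg as [|g Hg IH]; [simpl; lra |].
  rewrite <- !tech_pow_Rmult.
  assert (0 <= x ^ g) by (apply pow_le; lra). nra.
Qed.

(** [q] is the ratio of consecutive terms of [B].  Since the [g] ratios between [k0] and
    [k1] multiply to one and decrease at a definite rate, the last is below one by a definite
    amount and the first above one by as much; monotonicity propagates both outwards. *)
Lemma two_peak_decay (B q : nat -> R) (k0 g : nat) :
  (forall k, 0 < B k) ->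
  (forall k, B (S k) = B k * q (S k)) ->
  (forall i h, (1 <= i)%nat -> q (i + h)%nat <= q i * exp (- (INR h / (2 * INR (i + h))))) ->
  (1 <= g)%nat -> B k0 = B (k0 + g)%nat ->
  let sigma := (INR g - 1) / (4 * INR (k0 + g)) in
  (forall d, B (k0 + g + d)%nat <= B k0 * exp (- (sigma * INR d))) /\
  (forall d, (d <= k0)%nat -> B (k0 - d)%nat <= B k0 * exp (- (sigma * INR d))).
Proof.
  intros HB HBq Hq Hg Heq sigma.
  assert (Hqpos : forall k, 0 < q (S k)).
  { intros k. assert (H1 := HB k). assert (H2 := HB (S k)). rewrite HBq in H2. nra. }
  assert (Hg1 : 1 <= INR g) by (change 1 with (INR 1); apply le_INR; exact Hg).
  set (k1 := (k0 + g)%nat) in *.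
  assert (Hk1g : INR g <= INR k1) by (apply le_INR; unfold k1; lia).
  assert (Hk1 : 1 <= INR k1) by lra.
  assert (Hsig : 0 <= sigma).
  { unfold sigma. apply Rmult_le_pos; [lra |]. left; apply Rinv_0_lt_compat; lra. }
  assert (Hmono : forall i h, (1 <= i)%nat -> q (i + h)%nat <= q i).
  { intros i h Hi. eapply Rle_trans; [apply Hq, Hi |].
    assert (0 < q i) by (destruct i; [lia | apply Hqpos]).
    assert (exp (- (INR h / (2 * INR (i + h)))) <= exp 0).
    { apply exp_le_compat.
      assert (0 < INR (i + h)) by (apply lt_0_INR; lia).
      assert (0 <= INR h / (2 * INR (i + h))); [|lra].
      apply Rmult_le_pos; [apply pos_INR | left; apply Rinv_0_lt_compat; lra]. }
    rewrite exp_0 in *. nra. }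
  assert (Hfin : forall x, 0 <= x -> x ^ g <= 1 -> x <= 1).
  { intros x Hx Hx1. apply Rnot_lt_le. intros Hlt.
    assert (1 < x ^ g); [|lra]. apply Rlt_pow_R1; [exact Hlt | lia]. }
  assert (Hq1 : q k1 <= exp (- sigma)).
  { (* the [i] ratios ending at [k1] exceed [q k1] by the factors [exp (d / (2 k1))], [d < i] *)
    assert (Hind : forall i, (i <= g)%nat ->
      B (k1 - i)%nat * (q k1 ^ i * exp (INR i * (INR i - 1) / (4 * INR k1))) <= B k1).
    { induction i as [|i IH]; intros Hi.
      - rewrite Nat.sub_0_r. simpl. replace (0 * (0 - 1) / (4 * INR k1)) with 0 by (unfold Rdiv; ring).
        rewrite exp_0. lra.
      - eapply Rle_trans; [|apply IH; lia].
        replace (k1 - i)%nat with (S (k1 - S i)) by (unfold k1 in *; lia).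
        rewrite HBq. replace (S (k1 - S i)) with (k1 - i)%nat by (unfold k1 in *; lia).
        assert (H := Hq (k1 - i)%nat i ltac:(unfold k1; lia)).
        replace (k1 - i + i)%nat with k1 in H by (unfold k1 in *; lia).
        assert (Hqk : q k1 * exp (INR i / (2 * INR k1)) <= q (k1 - i)%nat).
        { apply (Rmult_le_compat_r (exp (INR i / (2 * INR k1)))) in H; [|left; apply exp_pos].
          rewrite Rmult_assoc, <- exp_plus, Rplus_opp_l, exp_0, Rmult_1_r in H. exact H. }
        rewrite S_INR.
        replace ((INR i + 1) * (INR i + 1 - 1) / (4 * INR k1))
          with (INR i / (2 * INR k1) + INR i * (INR i - 1) / (4 * INR k1)) by (field; lra).
        rewrite exp_plus, <- tech_pow_Rmult.
        assert (0 < exp (INR i * (INR i - 1) / (4 * INR k1))) by apply exp_pos.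
        assert (0 < q k1) by (replace k1 with (S (k1 - 1)) by (unfold k1; lia); apply Hqpos).
        assert (0 < q k1 ^ i) by (apply pow_lt; assumption).
        assert (HBp := HB (k1 - S i)%nat).
        replace (B (k1 - S i)%nat * (q k1 * q k1 ^ i * (exp (INR i / (2 * INR k1)) *
           exp (INR i * (INR i - 1) / (4 * INR k1)))))
          with (B (k1 - S i)%nat * (q k1 * exp (INR i / (2 * INR k1))) *
                (q k1 ^ i * exp (INR i * (INR i - 1) / (4 * INR k1)))) by ring.
        apply Rmult_le_compat_r; [apply Rmult_le_pos; lra |].
        apply Rmult_le_compat_l; lra. }
    specialize (Hind g (le_n _)).
    replace (k1 - g)%nat with k0 in Hind by (unfold k1; lia).
    rewrite <- Heq in Hind.
    replace (INR g * (INR g - 1) / (4 * INR k1)) with (INR g * sigma) in Hind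
      by (unfold sigma; field; lra).
    rewrite <- exp_pow, <- Rpow_mult_distr in Hind.
    assert (H0 := HB k0).
    assert (Hle : q k1 * exp sigma <= 1).
    { apply Hfin.
      - apply Rmult_le_pos; [|left; apply exp_pos].
        replace k1 with (S (k1 - 1)) by (unfold k1; lia). left; apply Hqpos.
      - nra. }
    rewrite exp_Ropp. apply Rmult_le_reg_r with (exp sigma); [apply exp_pos |].
    rewrite Rinv_l; [exact Hle | apply Rgt_not_eq, exp_pos]. }
  assert (Hq0 : exp sigma <= q (S k0)).
  { assert (Hind : forall i, (i <= g)%nat ->
      B (k0 + i)%nat <= B k0 * (q (S k0) ^ i * exp (- (INR i * (INR i - 1) / (4 * INR k1))))).
    { induction i as [|i IH]; intros Hi.
      - rewrite Nat.add_0_r. simpl. replace (- (0 * (0 - 1) / (4 * INR k1))) with 0 by (unfold Rdiv; ring).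
        rewrite exp_0. lra.
      - rewrite Nat.add_succ_r, HBq.
        assert (H := Hq (S k0) i ltac:(lia)). replace (S k0 + i)%nat with (S (k0 + i)) in H by lia.
        assert (Hqk : q (S (k0 + i)) <= q (S k0) * exp (- (INR i / (2 * INR k1)))).
        { eapply Rle_trans; [exact H |]. apply Rmult_le_compat_l; [left; apply Hqpos |].
          assert (Hle : INR i / (2 * INR k1) <= INR i / (2 * INR (S (k0 + i)))).
          { apply Rmult_le_compat_l; [apply pos_INR |].
            assert (0 < INR (S (k0 + i))) by (apply lt_0_INR; lia).
            assert (INR (S (k0 + i)) <= INR k1) by (apply le_INR; unfold k1; lia).
            apply Rinv_le_contravar; lra. }
          destruct Hle as [Hlt | ->]; [|lra]. left; apply exp_increasing; lra. }
        rewrite S_INR.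
        replace (- ((INR i + 1) * (INR i + 1 - 1) / (4 * INR k1)))
          with (- (INR i / (2 * INR k1)) + - (INR i * (INR i - 1) / (4 * INR k1))) by (field; lra).
        rewrite exp_plus, <- tech_pow_Rmult.
        specialize (IH ltac:(lia)).
        replace (B k0 * (q (S k0) * q (S k0) ^ i * (exp (- (INR i / (2 * INR k1))) *
           exp (- (INR i * (INR i - 1) / (4 * INR k1))))))
          with (B k0 * (q (S k0) ^ i * exp (- (INR i * (INR i - 1) / (4 * INR k1)))) *
                (q (S k0) * exp (- (INR i / (2 * INR k1))))) by ring.
        apply Rmult_le_compat; try assumption; left; [apply HB | apply Hqpos]. }
    specialize (Hind g (le_n _)). fold k1 in Hind.
    rewrite <- Heq in Hind.
    replace (- (INR g * (INR g - 1) / (4 * INR k1))) with (INR g * - sigma) in Hind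
      by (unfold sigma; field; lra).
    rewrite <- exp_pow, <- Rpow_mult_distr in Hind.
    assert (H0 := HB k0). apply Rnot_lt_le. intros Hlt.
    assert (Hq0 := Hqpos k0).
    assert (Hlt1 : q (S k0) * exp (- sigma) < 1).
    { rewrite exp_Ropp. apply Rmult_lt_reg_r with (exp sigma); [apply exp_pos |].
      rewrite Rmult_assoc, Rinv_l; [lra | apply Rgt_not_eq, exp_pos]. }
    assert (Hpow : (q (S k0) * exp (- sigma)) ^ g < 1); [|nra].
    rewrite <- (pow1 g). apply pow_lt_compat; [split; [|exact Hlt1] | exact Hg].
    apply Rmult_le_pos; [lra | left; apply exp_pos]. }
  split.
  - induction d as [|d IH].
    + rewrite Nat.add_0_r, <- Heq. simpl. rewrite Rmult_0_r, Ropp_0, exp_0. lra.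
    + rewrite Nat.add_succ_r, HBq, S_INR.
      replace (- (sigma * (INR d + 1))) with (- (sigma * INR d) + - sigma) by ring.
      rewrite exp_plus, <- Rmult_assoc.
      apply Rmult_le_compat; [left; apply HB | left; apply Hqpos | exact IH |].
      eapply Rle_trans; [|exact Hq1].
      replace (S (k1 + d)) with (k1 + S d)%nat by lia. apply Hmono. unfold k1; lia.
  - induction d as [|d IH]; intros Hd.
    + rewrite Nat.sub_0_r. simpl. rewrite Rmult_0_r, Ropp_0, exp_0. lra.
    + specialize (IH ltac:(lia)).
      replace (k0 - d)%nat with (S (k0 - S d)) in IH by lia. rewrite HBq in IH.
      assert (Hq' : exp sigma <= q (S (k0 - S d))).
      { eapply Rle_trans; [exact Hq0 |].
        replace (S k0) with (S (k0 - S d) + S d)%nat by lia. apply Hmono; lia. }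
      rewrite S_INR. replace (- (sigma * (INR d + 1))) with (- (sigma * INR d) + - sigma) by ring.
      rewrite exp_plus, <- Rmult_assoc, (exp_Ropp sigma).
      apply Rmult_le_reg_r with (exp sigma); [apply exp_pos |].
      rewrite Rmult_assoc, Rinv_l, Rmult_1_r by (apply Rgt_not_eq, exp_pos).
      eapply Rle_trans; [|exact IH]. apply Rmult_le_compat_l; [left; apply HB | exact Hq'].
Qed.

(** Half of the exponential decay is kept; the other half absorbs the cubic weight
    and the factor [(1 + tau)^m] that [two_term_zero] asks for. *)
Lemma weighted_decay (B : nat -> R) (k0 g m d : nat) :
  let k1 := (k0 + g)%nat in
  let sigma := (INR g - 1) / (4 * INR k1) in
  0 < B k0 -> (2 <= g)%nat ->
  B m <= B k0 * exp (- (sigma * INR d)) -> (m <= k1 + d)%nat -> (g - 1 <= d)%nat ->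
  B m * ((INR m + 1) * (1 + / (32 * INR k1 ^ 2)) ^ m) * ((INR m + 1) * (INR m + 2))
    <= B k0 * (2 * (INR k1 + 2) ^ 3 * (48 * INR k1) ^ 3 * exp (- ((INR g - 1) ^ 2 / (8 * INR k1)))).
Proof.
  intros k1 sigma HB Hg Hdec Hm Hd.
  assert (Hg2 : 2 <= INR g) by (change 2 with (INR 2); apply le_INR; exact Hg).
  assert (Hgk : INR g <= INR k1) by (apply le_INR; unfold k1; lia).
  assert (Hk : 2 <= INR k1) by lra.
  assert (Hdg : INR g - 1 <= INR d).
  { assert (INR g <= INR (S d)) by (apply le_INR; lia). rewrite S_INR in *. lra. }
  assert (Hmk : INR m <= INR k1 + INR d) by (rewrite <- plus_INR; apply le_INR; exact Hm).
  assert (Hm0 := pos_INR m).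
  set (tau := / (32 * INR k1 ^ 2)).
  assert (Hsk : sigma * (4 * INR k1) = INR g - 1) by (unfold sigma; field; lra).
  assert (Hsig : / (4 * INR k1) <= sigma).
  { unfold sigma, Rdiv. rewrite <- (Rmult_1_l (/ (4 * INR k1))) at 1.
    apply Rmult_le_compat_r; [left; apply Rinv_0_lt_compat; lra | lra]. }
  assert (Hsig0 : 0 < / (4 * INR k1)) by (apply Rinv_0_lt_compat; lra).
  assert (Hsig4 : sigma <= / 4) by nra.
  assert (Htau0 : 0 < tau) by (apply Rinv_0_lt_compat; nra).
  assert (Htau : tau = / (4 * INR k1) * / (8 * INR k1)) by (unfold tau; field; lra).
  assert (H8 : 0 < / (8 * INR k1) <= / 16).
  { split; [apply Rinv_0_lt_compat; lra | apply Rinv_le_contravar; lra]. }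
  assert (Htk : tau * INR k1 <= / 4).
  { replace (tau * INR k1) with (/ 4 * / (8 * INR k1)) by (unfold tau; field; lra). lra. }
  assert (Htd : tau * INR d <= sigma * INR d / 4).
  { assert (tau <= sigma / 4) by nra. nra. }
  assert (Hpow : (1 + tau) ^ m <= 2 * exp (sigma * INR d / 4)).
  { eapply Rle_trans; [apply one_plus_pow_le_exp; lra |].
    apply Rle_trans with (exp (/ 4 + sigma * INR d / 4)).
    - apply exp_le_compat. nra.
    - rewrite exp_plus. apply Rmult_le_compat_r; [left; apply exp_pos |].
      apply exp_le_two; lra. }
  assert (H1d : 1 + INR d <= 48 * INR k1 * exp (sigma * INR d / 12)).
  { apply Rle_trans with (48 * INR k1 * (1 + sigma * INR d / 12)).
    - assert (1 <= sigma * (4 * INR k1)) by lra. nra.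
    - apply Rmult_le_compat_l; [lra | apply exp_ineq1_le]. }
  assert (Hcube : (INR m + 2) ^ 3 <= (INR k1 + 2) ^ 3 * (48 * INR k1) ^ 3 * exp (sigma * INR d / 4)).
  { replace (exp (sigma * INR d / 4)) with (exp (sigma * INR d / 12) ^ 3)
      by (rewrite exp_pow; f_equal; simpl; field).
    rewrite <- !Rpow_mult_distr. apply pow_incr. split; [lra |].
    rewrite Rmult_assoc. apply Rle_trans with ((INR k1 + 2) * (1 + INR d)); [nra |].
    apply Rmult_le_compat_l; lra. }
  assert (Hw : (INR m + 1) * (INR m + 1) * (INR m + 2) <= (INR m + 2) ^ 3) by nra.
  assert (Hsplit : exp (- (sigma * INR d)) * (exp (sigma * INR d / 4) * exp (sigma * INR d / 4))
                   <= exp (- ((INR g - 1) ^ 2 / (8 * INR k1)))).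
  { rewrite <- !exp_plus. apply exp_le_compat.
    replace ((INR g - 1) ^ 2 / (8 * INR k1)) with (sigma * (INR g - 1) / 2)
      by (unfold sigma; field; lra).
    nra. }
  set (P := (1 + tau) ^ m) in *.
  assert (HP : 0 <= P) by (apply pow_le; lra).
  set (E4 := exp (sigma * INR d / 4)) in *.
  assert (HE4 : 0 < E4) by apply exp_pos.
  set (K := (INR k1 + 2) ^ 3 * (48 * INR k1) ^ 3) in *.
  assert (HK : 0 <= K) by (apply Rmult_le_pos; apply pow_le; lra).
  assert (Hw0 : 0 <= (INR m + 1) * (INR m + 1) * (INR m + 2)) by (repeat apply Rmult_le_pos; lra).
  replace (B m * ((INR m + 1) * P) * ((INR m + 1) * (INR m + 2)))
    with (B m * (P * ((INR m + 1) * (INR m + 1) * (INR m + 2)))) by ring.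
  apply Rle_trans with (B k0 * exp (- (sigma * INR d)) * (2 * E4 * (K * E4))).
  - apply Rle_trans with (B k0 * exp (- (sigma * INR d)) * (P * ((INR m + 1) * (INR m + 1) * (INR m + 2)))).
    + apply Rmult_le_compat_r; [apply Rmult_le_pos; assumption | exact Hdec].
    + apply Rmult_le_compat_l; [left; apply Rmult_lt_0_compat; [exact HB | apply exp_pos] |].
      apply Rmult_le_compat; try assumption. lra.
  - replace (B k0 * exp (- (sigma * INR d)) * (2 * E4 * (K * E4)))
      with (B k0 * (2 * K * (exp (- (sigma * INR d)) * (E4 * E4)))) by ring.
    replace (2 * (INR k1 + 2) ^ 3 * (48 * INR k1) ^ 3) with (2 * K) by (unfold K; ring).
    apply Rmult_le_compat_l; [lra |]. apply Rmult_le_compat_l; [lra | exact Hsplit].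
Qed.

(** * The set of exponents *)

(** The gap [sqrt j + 1] gives [lam j] the order of [j^(3/2)], so that the gap at an exponent
    [m] is of order [m^(1/3)]. *)
Fixpoint lam (j : nat) : nat :=
  match j with
  | O => O
  | S i => lam i + (Nat.sqrt i + 1)
  end.

(** The search stops at [m] because [j <= lam j]. *)
Definition is_lam (m : nat) : bool := existsb (fun j => Nat.eqb (lam j) m) (seq 0 (S m)).

Lemma lam_S (j : nat) : lam (S j) = (lam j + (Nat.sqrt j + 1))%nat.
Proof. reflexivity. Qed.

Lemma lam_ge (j : nat) : (j <= lam j)%nat.
Proof. induction j as [|j IH]; [simpl; lia | rewrite lam_S; lia]. Qed.

Lemma lam_le_mono (i j : nat) : (i <= j)%nat -> (lam i <= lam j)%nat.
Proof. induction 1 as [|j H IH]; [lia | rewrite lam_S; lia]. Qed.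

Lemma is_lam_lam (j : nat) : is_lam (lam j) = true.
Proof.
  apply existsb_exists. exists j. rewrite Nat.eqb_refl. split; [|reflexivity].
  apply in_seq. assert (H := lam_ge j). lia.
Qed.

Lemma is_lam_inv (m : nat) : is_lam m = true -> exists j, m = lam j.
Proof.
  intros H. apply existsb_exists in H as [j [_ H]]. exists j.
  symmetry. now apply Nat.eqb_eq.
Qed.

Lemma lam_upper (j : nat) : (lam j <= j * (Nat.sqrt j + 1))%nat.
Proof.
  induction j as [|j IH]; [simpl; lia |]. rewrite lam_S.
  assert (H := Nat.sqrt_le_mono j (S j) ltac:(lia)). nia.
Qed.

Lemma lam_lower (j : nat) : (j ^ 3 <= 4 * lam j ^ 2)%nat.
Proof.
  induction j as [|j IH]; [simpl; lia |]. rewrite lam_S.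
  assert (Hs := Nat.sqrt_spec j ltac:(lia)). destruct Hs as [_ Hs].
  set (s := Nat.sqrt j) in *. set (l := lam j) in *. clearbody s l.
  assert (Hs' : (j + 1 <= (s + 1) * (s + 1))%nat) by nia.
  (* the square of this inequality is the induction hypothesis times [Hs'] *)
  assert (H2 : (j * j <= 2 * (l * (s + 1)))%nat).
  { destruct (le_lt_dec (j * j) (2 * (l * (s + 1)))) as [|Hlt]; [assumption |].
    exfalso.
    assert (H4 : (j ^ 3 * (j + 1) <= 4 * l ^ 2 * ((s + 1) * (s + 1)))%nat)
      by (apply Nat.mul_le_mono; [exact IH | exact Hs']).
    assert (H5 : ((2 * (l * (s + 1))) * (2 * (l * (s + 1))) < (j * j) * (j * j))%nat)
      by (apply Nat.mul_lt_mono; exact Hlt).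
    simpl in H4. nia. }
  simpl in *. nia.
Qed.

Lemma lam_gap (j m : nat) : is_lam m = true -> m <> lam j -> m <> lam (S j) ->
  (m + Nat.sqrt j <= lam j)%nat \/ (lam (S j) + Nat.sqrt j <= m)%nat.
Proof.
  intros Hm H0 H1. apply is_lam_inv in Hm as [i ->].
  destruct (le_lt_dec i j) as [Hij | Hij].
  - left. destruct j as [|j]; [destruct i; [congruence | lia] |].
    assert (i <> S j) by congruence.
    assert (Hle := lam_le_mono i j ltac:(lia)). rewrite lam_S.
    assert (Hs : (Nat.sqrt (S j) <= S (Nat.sqrt j))%nat) by apply Nat.sqrt_succ_le.
    lia.
  - right. assert (i <> S j) by congruence.
    assert (Hle := lam_le_mono (S (S j)) i ltac:(lia)). rewrite (lam_S (S j)) in Hle.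
    assert (Hs := Nat.sqrt_le_mono j (S j) ltac:(lia)). lia.
Qed.

Lemma lam_bracket (x : R) : 0 <= x -> exists j, INR (lam j) <= x < INR (lam (S j)).
Proof.
  intros Hx.
  assert (H : forall N, x < INR (lam N) -> exists j, INR (lam j) <= x < INR (lam (S j))).
  { induction N as [|N IH]; intros HN; [simpl in HN; lra |].
    destruct (Rle_lt_dec (INR (lam N)) x) as [Hle | Hlt]; [now exists N | auto]. }
  destruct (nfloor_ex x Hx) as [N [_ HN]].
  apply (H (S N)). 
  eapply Rlt_le_trans; [apply HN |]. rewrite <- S_INR. apply le_INR, lam_ge.
Qed.

Definition lac (m : nat) : R := if is_lam m then / sqrt (INR (fact m)) else 0.

(** * Two dominant terms in the derivatives *)

(** The coefficient [(n + k)! / (sqrt ((n + k)!) k!)] of [z^k] in the [n]-th derivative when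
    [n + k] is an exponent. *)
Definition weight (n k : nat) : R := sqrt (INR (fact (n + k))) / INR (fact k).

Lemma sqrt_fact_pos (m : nat) : 0 < sqrt (INR (fact m)).
Proof. apply sqrt_lt_R0, INR_fact_lt_0. Qed.

Lemma weight_pos (n k : nat) : 0 < weight n k.
Proof. apply Rdiv_lt_0_compat; [apply sqrt_fact_pos | apply INR_fact_lt_0]. Qed.

Lemma shift_lac (n k : nat) :
  shift_coef n lac k = if is_lam (n + k) then weight n k else 0.
Proof.
  unfold shift_coef, lac, weight. destruct (is_lam (n + k)); [|unfold Rdiv; ring].
  assert (H := sqrt_fact_pos (n + k)). assert (H' := INR_fact_neq_0 k).
  rewrite <- (sqrt_sqrt (INR (fact (n + k)))) at 2 by (left; apply INR_fact_lt_0).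
  field. split; [exact H' | lra].
Qed.

Lemma weight_S (n k : nat) :
  weight n (S k) = weight n k * (sqrt (INR (n + S k)) / INR (S k)).
Proof.
  unfold weight. replace (n + S k)%nat with (S (n + k)) by lia.
  rewrite !fact_simpl, !mult_INR, sqrt_mult by apply pos_INR.
  field. split; [apply not_0_INR; lia | apply INR_fact_neq_0].
Qed.

(** Quantitative log-concavity of [weight n k * r^k]: the factor [1 / k] of the ratio of
    consecutive terms decreases, while [sqrt (n + k)] grows at most like [sqrt k] and gives
    back only half of that decrease. *)
Lemma weight_ratio_decay (n : nat) (r : R) (i h : nat) : 0 <= r -> (1 <= i)%nat ->
  r * (sqrt (INR (n + (i + h))) / INR (i + h))
    <= r * (sqrt (INR (n + i)) / INR i) * exp (- (INR h / (2 * INR (i + h)))).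
Proof.
  intros Hr Hi. rewrite Rmult_assoc. apply Rmult_le_compat_l; [exact Hr |].
  assert (Hi1 : 1 <= INR i) by (change 1 with (INR 1); apply le_INR; exact Hi).
  assert (Hh := pos_INR h). assert (Hn := pos_INR n).
  assert (He := exp_ineq1_le (- (INR h / (2 * INR (i + h))))).
  rewrite !plus_INR in *. set (I := INR i) in *. set (H := INR h) in *. set (N := INR n) in *.
  clearbody I H N.
  assert (Hsq : sqrt (N + (I + H)) <= sqrt (N + I) * (1 + H / (2 * I))).
  { assert (Hq : 0 <= H / (2 * I)) by (apply Rmult_le_pos; [exact Hh | left; apply Rinv_0_lt_compat; lra]).
    rewrite <- (sqrt_pow2 (1 + H / (2 * I))), <- sqrt_mult by (try lra; apply pow2_ge_0).
    apply sqrt_le_1_alt.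
    assert (HI : H / (2 * I) * (2 * I) = H) by (field; lra).
    set (q := H / (2 * I)) in *. clearbody q.
    assert (0 <= N * q) by (apply Rmult_le_pos; assumption).
    assert (0 <= (N + I) * q ^ 2) by (apply Rmult_le_pos; [lra | apply pow2_ge_0]).
    nra. }
  assert (Hs0 := sqrt_pos (N + I)).
  apply Rle_trans with (sqrt (N + I) / I * (1 - H / (2 * (I + H)))).
  - replace (sqrt (N + I) / I * (1 - H / (2 * (I + H))))
      with (sqrt (N + I) * (1 + H / (2 * I)) / (I + H)) by (field; lra).
    apply Rmult_le_compat_r; [left; apply Rinv_0_lt_compat; lra | exact Hsq].
  - apply Rmult_le_compat_l; [|lra].
    apply Rmult_le_pos; [exact Hs0 | left; apply Rinv_0_lt_compat; lra].
Qed.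

(** The equation is [r^g = weight n k0 / weight n (k0 + g)], and the right-hand side is a
    product of [g] factors [(k0 + i) / sqrt (n + k0 + i)], so [r] is their geometric mean. *)
Lemma balanced_radius (n k0 g : nat) : (1 <= n)%nat -> (1 <= g)%nat ->
  exists r, 0 < r /\
    weight n k0 * r ^ k0 = weight n (k0 + g) * r ^ (k0 + g) /\
    INR k0 / sqrt (INR (n + k0 + g)) <= r <= INR (k0 + g) / sqrt (INR n).
Proof.
  intros Hn Hg.
  assert (H0 := weight_pos n k0). assert (H1 := weight_pos n (k0 + g)).
  set (x := weight n k0 / weight n (k0 + g)).
  assert (Hx : 0 < x) by (apply Rdiv_lt_0_compat; assumption).
  set (r := Rpower x (/ INR g)).
  assert (Hg0 : INR g <> 0) by (apply not_0_INR; lia).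
  assert (Hr : 0 < r) by (unfold r, Rpower; apply exp_pos).
  assert (Hrg : r ^ g = x).
  { rewrite <- Rpower_pow by exact Hr. unfold r.
    rewrite Rpower_mult, Rinv_l, Rpower_1 by assumption. reflexivity. }
  assert (HnR : 1 <= INR n) by (change 1 with (INR 1); apply le_INR; exact Hn).
  assert (Hsn : 0 < sqrt (INR n)) by (apply sqrt_lt_R0; lra).
  assert (Hk1 : 0 < INR (k0 + g)) by (apply lt_0_INR; lia).
  assert (Hnk : 0 < INR (n + k0 + g)) by (apply lt_0_INR; lia).
  assert (Hsnk : 0 < sqrt (INR (n + k0 + g))) by (apply sqrt_lt_R0; exact Hnk).
  exists r. split; [exact Hr |]. split.
  { rewrite pow_add, Hrg. unfold x. field. lra. }
  assert (Hup : forall i, (i <= g)%nat ->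
     weight n k0 * (sqrt (INR n) / INR (k0 + g)) ^ i <= weight n (k0 + i)).
  { induction i as [|i IH]; intros Hi; [rewrite Nat.add_0_r; simpl; lra |].
    rewrite Nat.add_succ_r, weight_S, <- tech_pow_Rmult.
    replace (weight n k0 * (sqrt (INR n) / INR (k0 + g) * (sqrt (INR n) / INR (k0 + g)) ^ i))
      with (weight n k0 * (sqrt (INR n) / INR (k0 + g)) ^ i * (sqrt (INR n) / INR (k0 + g))) by ring.
    assert (Hq : 0 <= sqrt (INR n) / INR (k0 + g))
      by (apply Rmult_le_pos; [lra | left; apply Rinv_0_lt_compat; lra]).
    apply Rmult_le_compat; [apply Rmult_le_pos; [lra | now apply pow_le] | exact Hq | apply IH; lia |].
    apply Rmult_le_compat; [lra | left; apply Rinv_0_lt_compat; lra | |].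
    - apply sqrt_le_1_alt, le_INR; lia.
    - apply Rinv_le_contravar; [apply lt_0_INR; lia | apply le_INR; lia]. }
  split.
  - apply Rnot_lt_le. intros Hlt.
    destruct k0 as [|k0']; [simpl in Hlt; unfold Rdiv in Hlt; rewrite Rmult_0_l in Hlt; lra |].
    set (k0 := S k0') in *.
    assert (Hk0 : 0 < INR k0) by (apply lt_0_INR; unfold k0; lia).
    assert (Hlow : forall i, (i <= g)%nat ->
       weight n (k0 + i) <= weight n k0 * (sqrt (INR (n + k0 + g)) / INR k0) ^ i).
    { induction i as [|i IH]; intros Hi; [rewrite Nat.add_0_r; simpl; lra |].
      rewrite Nat.add_succ_r, weight_S, <- tech_pow_Rmult.
      replace (weight n k0 * (sqrt (INR (n + k0 + g)) / INR k0 * (sqrt (INR (n + k0 + g)) / INR k0) ^ i))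
        with (weight n k0 * (sqrt (INR (n + k0 + g)) / INR k0) ^ i * (sqrt (INR (n + k0 + g)) / INR k0)) by ring.
      apply Rmult_le_compat; [left; apply weight_pos | | apply IH; lia |].
      - apply Rmult_le_pos; [apply sqrt_pos | left; apply Rinv_0_lt_compat, lt_0_INR; lia].
      - apply Rmult_le_compat; [apply sqrt_pos | left; apply Rinv_0_lt_compat, lt_0_INR; lia | |].
        + apply sqrt_le_1_alt, le_INR; lia.
        + apply Rinv_le_contravar; [exact Hk0 | apply le_INR; lia]. }
    assert (Hp := pow_lt_compat r (INR k0 / sqrt (INR (n + k0 + g))) g ltac:(lra) Hg).
    rewrite Hrg in Hp. specialize (Hlow g (le_n _)).
    replace (sqrt (INR (n + k0 + g)) / INR k0) with (/ (INR k0 / sqrt (INR (n + k0 + g)))) in Hlow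
      by (field; lra).
    rewrite pow_inv in Hlow.
    set (y := (INR k0 / sqrt (INR (n + k0 + g))) ^ g) in *.
    apply (Rmult_le_compat_r y) in Hlow; [|lra].
    rewrite Rmult_assoc, Rinv_l, Rmult_1_r in Hlow by lra.
    apply (Rmult_lt_compat_l (weight n (k0 + g))) in Hp; [|exact H1].
    unfold x in Hp. replace (weight n (k0 + g) * (weight n k0 / weight n (k0 + g)))
      with (weight n k0) in Hp by (field; lra). lra.
  - apply Rnot_lt_le. intros Hlt.
    assert (Hq : 0 < INR (k0 + g) / sqrt (INR n)) by (apply Rdiv_lt_0_compat; lra).
    assert (Hp := pow_lt_compat (INR (k0 + g) / sqrt (INR n)) r g ltac:(lra) Hg).
    rewrite Hrg in Hp. specialize (Hup g (le_n _)).
    replace (sqrt (INR n) / INR (k0 + g)) with (/ (INR (k0 + g) / sqrt (INR n))) in Hup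
      by (field; lra).
    rewrite pow_inv in Hup.
    assert (Hy : 0 < (INR (k0 + g) / sqrt (INR n)) ^ g) by (apply pow_lt; exact Hq).
    set (y := (INR (k0 + g) / sqrt (INR n)) ^ g) in *.
    apply (Rmult_le_compat_r y) in Hup; [|lra].
    rewrite Rmult_assoc, Rinv_l, Rmult_1_r in Hup by lra.
    apply (Rmult_lt_compat_l (weight n (k0 + g))) in Hp; [|exact H1].
    unfold x in Hp. replace (weight n (k0 + g) * (weight n k0 / weight n (k0 + g)))
      with (weight n k0) in Hp by (field; lra). lra.
Qed.

(** Divided by its term of exponent [k0] at [zeta], the derivative is a series in [1 + u] with
    coefficients [1] at [k0], [-1] at [k1], and all others covered by [weighted_decay]. *)
Lemma shift_lac_zero (n j k0 : nat) (r : R) (zeta : C) :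
  let g := (Nat.sqrt j + 1)%nat in
  let k1 := (k0 + g)%nat in
  entire_coef lac -> lam j = (n + k0)%nat -> (2 <= g)%nat -> 0 < r ->
  weight n k0 * r ^ k0 = weight n k1 * r ^ k1 ->
  Cmod zeta = r -> (zeta ^ g)%C = (- RtoC (r ^ g))%C ->
  2 * (INR k1 + 2) ^ 3 * (48 * INR k1) ^ 3 * exp (- ((INR g - 1) ^ 2 / (8 * INR k1)))
    <= / (64 * INR k1 ^ 2) ->
  exists u, Cmod u <= / (32 * INR k1 ^ 2) /\ CPS (shift_coef n lac) (zeta * (1 + u))%C = RtoC 0.
Proof.
  intros g k1 Hent Hj Hg Hr Hbal Hz Hzg Hsmall.
  set (B := fun k => weight n k * r ^ k).
  assert (HB : forall k, 0 < B k)
    by (intros; apply Rmult_lt_0_compat; [apply weight_pos | apply pow_lt; exact Hr]).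
  destruct (two_peak_decay B (fun i => r * (sqrt (INR (n + i)) / INR i)) k0 g HB) as [Hright Hleft].
  { intros k. unfold B. rewrite weight_S. simpl pow. ring. }
  { intros i h Hi. apply weight_ratio_decay; [lra | exact Hi]. }
  { lia. }
  { exact Hbal. }
  fold k1 in Hright, Hleft.
  assert (Hk1 : (n + k1)%nat = lam (S j)) by (rewrite lam_S, Hj; unfold k1, g; lia).
  assert (Hlam0 : is_lam (n + k0) = true) by (rewrite <- Hj; apply is_lam_lam).
  assert (Hlam1 : is_lam (n + k1) = true) by (rewrite Hk1; apply is_lam_lam).
  assert (Hz0 : zeta <> RtoC 0) by (intros ->; rewrite Cmod_0 in Hz; lra).
  assert (Hzk : forall k, (zeta ^ k)%C <> RtoC 0) by (intros; apply Cpow_nz, Hz0).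
  set (A := (RtoC (weight n k0) * zeta ^ k0)%C).
  assert (Hw0 : RtoC (weight n k0) <> RtoC 0).
  { intros H; apply RtoC_inj in H. assert (Hw := weight_pos n k0). lra. }
  assert (HA : A <> RtoC 0) by (apply Cmult_neq_0; [exact Hw0 | apply Hzk]).
  assert (HAmod : Cmod A = B k0).
  { unfold A, B. rewrite Cmod_mult, Cmod_pow, Hz, Cmod_R, Rabs_pos_eq; [reflexivity |].
    left; apply weight_pos. }
  set (p := fun m => (RtoC (shift_coef n lac m) * zeta ^ m / A)%C).
  assert (Hpmod : forall m, Cmod (p m) = (if is_lam (n + m) then B m else 0) / B k0).
  { intros m. unfold p. rewrite Cmod_div, HAmod, Cmod_mult, Cmod_pow, Hz, Cmod_R, shift_lac
      by exact HA.
    destruct (is_lam (n + m)).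
    - rewrite Rabs_pos_eq by (left; apply weight_pos). reflexivity.
    - rewrite Rabs_R0, Rmult_0_l. reflexivity. }
  destruct (two_term_zero p k0 k1 (/ (64 * INR k1 ^ 2))) as [u [Hu Hzero]].
  - unfold k1; lia.
  - unfold p. rewrite shift_lac, Hlam0. fold A. field. exact HA.
  - unfold p, A. rewrite shift_lac, Hlam1. unfold k1. rewrite Cpow_add_r, Hzg.
    assert (Hw : weight n k1 * r ^ g = weight n k0).
    { unfold k1 in Hbal |- *. rewrite pow_add in Hbal.
      assert (0 < r ^ k0) by (apply pow_lt; exact Hr).
      apply Rmult_eq_reg_r with (r ^ k0); lra. }
    fold k1. rewrite <- Hw in Hw0 |- *. rewrite RtoC_mult in *.
    generalize dependent (RtoC (r ^ g)). intros rg _ Hrg.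
    assert (Ha := Cmult_neq_0 _ _ Hrg (Hzk k0)).
    replace (weight n k1 * (zeta ^ k0 * - rg))%C with (- (weight n k1 * rg * zeta ^ k0))%C by ring.
    generalize dependent (weight n k1 * rg * zeta ^ k0)%C. intros a Ha. field. exact Ha.
  - lra.
  - intros m Hm0 Hm1. eapply Rle_trans; [|exact Hsmall].
    assert (HK1 : 0 < INR k1) by (apply lt_0_INR; unfold k1; lia).
    assert (Hmain : is_lam (n + m) = true -> exists d, B m <= B k0 * exp (- ((INR g - 1) / (4 * INR k1) * INR d))
              /\ (m <= k1 + d)%nat /\ (g - 1 <= d)%nat).
    { intros Hm. destruct (lam_gap j (n + m) Hm) as [Hl | Hl].
      - rewrite Hj; lia.
      - rewrite <- Hk1; lia.
      - exists (k0 - m)%nat. rewrite Hj in Hl.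
        assert (H := Hleft (k0 - m)%nat ltac:(lia)).
        replace (k0 - (k0 - m))%nat with m in H by lia.
        split; [exact H | unfold k1, g in *; lia].
      - exists (m - k1)%nat. rewrite <- Hk1 in Hl.
        assert (H := Hright (m - k1)%nat).
        replace (k1 + (m - k1))%nat with m in H by lia.
        split; [exact H | unfold k1, g in *; lia]. }
    rewrite Hpmod. destruct (is_lam (n + m)) eqn:Hm.
    + destruct (Hmain eq_refl) as [d [Hd1 [Hd2 Hd3]]].
      assert (H := weighted_decay B k0 g m d (HB k0) Hg Hd1 Hd2 Hd3). fold k1 in H.
      apply Rmult_le_reg_l with (B k0); [apply HB |].
      eapply Rle_trans; [|exact H]. right. field. apply Rgt_not_eq, HB.
    + unfold Rdiv. rewrite !Rmult_0_l.
      repeat apply Rmult_le_pos; try lra; try (apply pow_le; lra). left; apply exp_pos.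
  - exists u. split; [exact Hu |].
    replace (RtoC 0) with (A * CSeries (fun m => p m * (1 + u) ^ m))%C by (rewrite Hzero; ring).
    unfold CPS. rewrite <- CSeries_scal.
    + apply CSeries_ext. intros m. unfold p. rewrite Cpow_mult_l. field. exact HA.
    + assert (Hex := ex_CPS (shift_coef n lac) (zeta * (1 + u))%C (entire_coef_shift n lac Hent)).
      apply (ex_Cseries_scal (/ A)) in Hex.
      revert Hex. apply ex_Cseries_dominated. intros m. right. f_equal.
      unfold p. rewrite Cpow_mult_l. field. exact HA.
Qed.

(** * Points of prescribed argument *)

Definition cis (x : R) : C := (cos x, sin x).

Lemma cis_plus (x y : R) : cis (x + y) = (cis x * cis y)%C.
Proof.
  unfold cis, Cmult; simpl. rewrite cos_plus, sin_plus. f_equal; ring.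
Qed.

Lemma cis_pow (x : R) (n : nat) : (cis x ^ n)%C = cis (INR n * x).
Proof.
  induction n as [|n IH].
  - simpl. rewrite Rmult_0_l. unfold cis. rewrite cos_0, sin_0. reflexivity.
  - rewrite S_INR. replace ((INR n + 1) * x) with (x + INR n * x) by ring.
    rewrite cis_plus, <- IH. reflexivity.
Qed.

Lemma Cmod_cis (x : R) : Cmod (cis x) = 1.
Proof.
  unfold Cmod, cis; simpl. rewrite !Rmult_1_r.
  replace (cos x * cos x + sin x * sin x) with 1; [apply sqrt_1 |].
  assert (H := sin2_cos2 x). unfold Rsqr in H. lra.
Qed.

Lemma cis_odd_pi (t : nat) : cis ((2 * INR t + 1) * PI) = (- RtoC 1)%C.
Proof.
  replace ((2 * INR t + 1) * PI) with (PI + 2 * INR t * PI) by ring.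
  unfold cis. rewrite cos_period, sin_period, cos_PI, sin_PI.
  unfold Copp, RtoC; simpl. f_equal; ring.
Qed.

Lemma Rabs_sin_le (x : R) : Rabs (sin x) <= Rabs x.
Proof.
  assert (Hpos : forall y, 0 <= y -> Rabs (sin y) <= y).
  { intros y Hy. destruct (Rle_lt_dec y 1) as [H1 | H1].
    - assert (HPI := PI2_1). rewrite Rabs_pos_eq.
      + destruct Hy as [Hy | <-]; [left; apply sin_lt_x; exact Hy | rewrite sin_0; lra].
      + apply sin_ge_0; lra.
    - assert (H := SIN_bound y). apply Rabs_le. lra. }
  destruct (Rle_lt_dec 0 x) as [H | H].
  - rewrite (Rabs_pos_eq x H). apply Hpos, H.
  - rewrite (Rabs_left x H), <- Rabs_Ropp, <- sin_neg. apply Hpos. lra.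
Qed.

Lemma Cmod_cis_sub_le (x y : R) : Cmod (cis x - cis y)%C <= 2 * Rabs (x - y).
Proof.
  assert (H := Cmod_le_sum (cis x - cis y)%C). simpl in H.
  change (cos x + - cos y) with (cos x - cos y) in H.
  change (sin x + - sin y) with (sin x - sin y) in H.
  rewrite form2, form4, !Rabs_mult in H.
  assert (H1 := Rabs_sin_le ((x - y) / 2)).
  assert (H2 : Rabs (sin ((x + y) / 2)) <= 1) by (apply Rabs_le, SIN_bound).
  assert (H3 : Rabs (cos ((x + y) / 2)) <= 1) by (apply Rabs_le, COS_bound).
  assert (H4 : Rabs ((x - y) / 2) = Rabs (x - y) / 2).
  { unfold Rdiv. rewrite Rabs_mult, (Rabs_pos_eq (/ 2)) by lra. reflexivity. }
  replace (Rabs (-2)) with 2 in H by (rewrite Rabs_left; lra).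
  rewrite (Rabs_pos_eq 2) in H by lra.
  assert (P1 := Rabs_pos (sin ((x - y) / 2))).
  assert (P2 := Rabs_pos (sin ((x + y) / 2))). assert (P3 := Rabs_pos (cos ((x + y) / 2))).
  nra.
Qed.

Lemma polar_form (z : C) : exists x, 0 <= x /\ z = (Cmod z * cis x)%C.
Proof.
  destruct (Rle_lt_or_eq_dec 0 (Cmod z) (Cmod_ge_0 z)) as [Hz | Hz].
  2:{ exists 0. split; [lra |]. rewrite (Cmod_eq_0 z) by lra. rewrite Cmod_0. ring. }
  set (c := fst z / Cmod z). set (s := snd z / Cmod z).
  assert (Hcs : c * c + s * s = 1).
  { unfold c, s. assert (H := Cmod2_alt z). unfold Re, Im in H.
    apply Rmult_eq_reg_r with (Cmod z ^ 2); [|apply pow_nonzero; lra].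
    replace ((fst z / Cmod z * (fst z / Cmod z) + snd z / Cmod z * (snd z / Cmod z)) * Cmod z ^ 2)
      with (fst z ^ 2 + snd z ^ 2) by (field; lra). lra. }
  assert (Hc : -1 <= c <= 1) by nra.
  assert (Hab := acos_bound c).
  assert (Hsa : sin (acos c) = Rabs s).
  { rewrite sin_acos by exact Hc. rewrite <- (sqrt_Rsqr_abs s). f_equal. unfold Rsqr. lra. }
  assert (Hfin : forall x, cos x = c -> sin x = s -> z = (Cmod z * cis x)%C).
  { intros x Hx Hy. unfold cis. rewrite Hx, Hy. unfold c, s, Cmult, RtoC; simpl.
    rewrite (surjective_pairing z) at 1. f_equal; field; lra. }
  destruct (Rle_lt_dec 0 s) as [Hs | Hs].
  - exists (acos c). split; [apply Hab |]. apply Hfin; [apply cos_acos, Hc |].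
    rewrite Hsa. apply Rabs_pos_eq, Hs.
  - exists (- acos c + 2 * INR 1 * PI). split; [simpl; lra |].
    apply Hfin; rewrite ?cos_period, ?sin_period, ?cos_neg, ?sin_neg.
    + apply cos_acos, Hc.
    + rewrite Hsa, Rabs_left by exact Hs. ring.
Qed.

(** The [g] solutions of [zeta^g = -r^g] are spaced by [2 pi / g] in argument. *)
Lemma opposite_root_near (z : C) (r : R) (g : nat) : 0 <= r -> (1 <= g)%nat ->
  exists zeta, Cmod zeta = r /\ (zeta ^ g)%C = (- RtoC (r ^ g))%C /\
    Cmod (zeta - z)%C <= Rabs (r - Cmod z) + 8 * Cmod z / INR g.
Proof.
  intros Hr Hg. destruct (polar_form z) as [x [Hx Hz]].
  assert (HPI := PI_RGT_0). assert (HPI4 := PI_4).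
  assert (Hg0 : 0 < INR g) by (apply lt_0_INR; lia).
  (* the odd multiple of [PI] closest to [g x] is [2 t + 1] times [PI] *)
  destruct (nfloor_ex (INR g * x / (2 * PI))) as [t [Ht1 Ht2]].
  { apply Rmult_le_pos; [nra | left; apply Rinv_0_lt_compat; lra]. }
  apply Rle_div_r in Ht1; [|lra]. apply Rlt_div_l in Ht2; [|lra].
  set (th := (2 * INR t + 1) * PI / INR g).
  exists (r * cis th)%C. split; [|split].
  - rewrite Cmod_mult, Cmod_cis, Cmod_R, Rabs_pos_eq by exact Hr. ring.
  - rewrite Cpow_mult_l, <- RtoC_pow, cis_pow.
    replace (INR g * th) with ((2 * INR t + 1) * PI) by (unfold th; field; lra).
    rewrite cis_odd_pi. ring.
  - replace (r * cis th - z)%C with (RtoC (r - Cmod z) * cis th + Cmod z * (cis th - cis x))%C.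
    2:{ rewrite RtoC_minus. revert Hz. generalize (Cmod z). intros rho ->. ring. }
    eapply Rle_trans; [apply Cmod_triangle |].
    rewrite !Cmod_mult, Cmod_cis, !Cmod_R, (Rabs_pos_eq (Cmod z)) by apply Cmod_ge_0.
    rewrite Rmult_1_r. apply Rplus_le_compat_l.
    replace (8 * Cmod z / INR g) with (Cmod z * (2 * (4 / INR g))) by (field; lra).
    apply Rmult_le_compat_l; [apply Cmod_ge_0 |].
    eapply Rle_trans; [apply Cmod_cis_sub_le |]. apply Rmult_le_compat_l; [lra |].
    assert (Hth : th - x = ((2 * INR t + 1) * PI - INR g * x) * / INR g) by (unfold th; field; lra).
    rewrite Hth, Rabs_mult, (Rabs_pos_eq (/ INR g)) by (left; apply Rinv_0_lt_compat, Hg0).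
    apply Rmult_le_compat_r; [left; apply Rinv_0_lt_compat, Hg0 |].
    apply Rabs_le. nra.
Qed.

(** * Zeros near every point *)

Lemma exp_dominates_pow (K c : R) (N : nat) : 0 < c ->
  exists Y, forall y, Y <= y -> 0 < y -> K * y ^ N <= exp (c * y).
Proof.
  intros Hc. set (b := c / INR (S N)).
  assert (HN : 0 < INR (S N)) by (apply lt_0_INR; lia).
  assert (Hb : 0 < b) by (apply Rdiv_lt_0_compat; assumption).
  assert (HbS : 0 < b ^ S N) by (apply pow_lt, Hb).
  exists (K / b ^ S N). intros y HY Hy.
  apply Rle_div_l in HY; [|exact HbS].
  apply Rle_trans with ((b * y) ^ S N).
  - rewrite Rpow_mult_distr, <- (tech_pow_Rmult y), <- Rmult_assoc, (Rmult_comm _ y).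
    apply Rmult_le_compat_r; [apply pow_le; lra | exact HY].
  - apply Rle_trans with (exp (b * y) ^ S N).
    + apply pow_incr. split; [apply Rmult_le_pos; lra |].
      assert (H := exp_ineq1_le (b * y)). lra.
    + rewrite exp_pow. right. f_equal. unfold b. field. lra.
Qed.

(** With [y = sqrt g], which avoids fractional powers of [n], the gap is [y^2] while [sqrt n]
    is of order [y^3]. *)
Lemma gap_scale (rho : R) (n j : nat) :
  let g := (Nat.sqrt j + 1)%nat in
  0 < rho -> (1 <= n)%nat ->
  INR (lam j) <= INR n + rho * sqrt (INR n) < INR (lam (S j)) ->
  INR n <= 2 * INR g ^ 3 /\
  ((2 <= g)%nat -> / (4 * (1 + rho)) * sqrt (INR g) ^ 3 <= sqrt (INR n)).
Proof.
  intros g Hrho Hn [Hl Hu].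
  assert (Hn1 : 1 <= INR n) by (change 1 with (INR 1); apply le_INR; exact Hn).
  assert (Hsn := sqrt_pos (INR n)). assert (Hsn2 := sqrt_sqrt (INR n) ltac:(lra)).
  assert (Hsn1 : 1 <= sqrt (INR n)) by (rewrite <- sqrt_1; apply sqrt_le_1_alt; exact Hn1).
  destruct (Nat.sqrt_spec j ltac:(lia)) as [Hs1 Hs2].
  assert (Hg1 : 1 <= INR g) by (change 1 with (INR 1); apply le_INR; unfold g; lia).
  split.
  - assert (HuN : (lam (S j) <= 2 * g ^ 3)%nat).
    { rewrite lam_S. fold g. assert (H := lam_upper j). fold g in H.
      replace (S (Nat.sqrt j)) with g in Hs2 by (unfold g; lia).
      assert (H3 : (j * g <= g * g * g)%nat) by (apply Nat.mul_le_mono_r; lia).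
      assert (H4 : (1 <= g)%nat) by (unfold g; lia). simpl. nia. }
    apply le_INR in HuN. rewrite mult_INR, pow_INR in HuN. simpl (INR 2) in HuN.
    assert (0 <= rho * sqrt (INR n)) by (apply Rmult_le_pos; lra). lra.
  - intros Hg2. set (s := Nat.sqrt j) in *.
    assert (Hlow : (s ^ 3 <= 2 * lam j)%nat).
    { assert (H := lam_lower j).
      assert (H2 : ((s * s) ^ 3 <= j ^ 3)%nat) by (apply Nat.pow_le_mono_l; exact Hs1).
      assert (H3 : (s ^ 3 * s ^ 3 <= (2 * lam j) * (2 * lam j))%nat).
      { rewrite Nat.pow_mul_l in H2. simpl in *. nia. }
      destruct (le_lt_dec (s ^ 3) (2 * lam j)) as [|Hlt]; [assumption |].
      assert (((2 * lam j) * (2 * lam j) < s ^ 3 * s ^ 3)%nat)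
        by (apply Nat.mul_lt_mono; exact Hlt). lia. }
    assert (Hg3 : (g ^ 3 <= 16 * lam j)%nat).
    { assert (H : (g ^ 3 <= (2 * s) ^ 3)%nat) by (apply Nat.pow_le_mono_l; unfold g in *; lia).
      rewrite Nat.pow_mul_l in H. change (2 ^ 3)%nat with 8%nat in H. lia. }
    apply le_INR in Hg3. rewrite mult_INR, pow_INR in Hg3.
    replace (INR 16) with 16 in Hg3 by (simpl; lra).
    assert (Hbound : INR g ^ 3 <= 16 * ((1 + rho) * INR n)).
    { eapply Rle_trans; [exact Hg3 |]. apply Rmult_le_compat_l; [lra |].
      assert (rho * sqrt (INR n) <= rho * INR n) by (apply Rmult_le_compat_l; nra). lra. }
    set (y := sqrt (INR g)). assert (Hy : y * y = INR g) by (apply sqrt_sqrt; lra).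
    rewrite <- Hy in Hbound.
    assert (Hk : 0 < / (4 * (1 + rho))) by (apply Rinv_0_lt_compat; lra).
    assert (Hy0 : 0 <= y) by apply sqrt_pos.
    apply Rsqr_incr_0_var; [|exact Hsn]. unfold Rsqr. rewrite Hsn2.
    replace (/ (4 * (1 + rho)) * y ^ 3 * (/ (4 * (1 + rho)) * y ^ 3))
      with ((y * y) ^ 3 / (16 * (1 + rho) ^ 2)) by (field; lra).
    apply Rle_div_l; [nra |]. nra.
Qed.

(** The bound of [weighted_decay] is a power of [K1], hence of [y], times
    [exp (- y / (128 rho))], since [S1^2] has order [y^4] and [K1] has order [y^3]. *)
Lemma lac_tail_small (rho y K1 S1 : R) :
  0 < rho -> 0 < K1 -> 1 <= y -> K1 <= 4 * rho * y ^ 3 -> y ^ 2 / 2 <= S1 ->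
  128 * 48 ^ 3 * (4 * rho + 2) ^ 8 * y ^ 24 <= exp (/ (128 * rho) * y) ->
  2 * (K1 + 2) ^ 3 * (48 * K1) ^ 3 * exp (- (S1 ^ 2 / (8 * K1))) <= / (64 * K1 ^ 2).
Proof.
  intros Hrho HK1 Hy HK HS Hexp.
  assert (Hy3 : 1 <= y ^ 3) by (apply pow_R1_Rle; exact Hy).
  set (X := exp (S1 ^ 2 / (8 * K1))).
  assert (HX : 0 < X) by apply exp_pos.
  assert (Hmain : 128 * 48 ^ 3 * (K1 + 2) ^ 8 <= X).
  { apply Rle_trans with (128 * 48 ^ 3 * ((4 * rho + 2) * y ^ 3) ^ 8).
    - apply Rmult_le_compat_l; [lra |]. apply pow_incr. split; [lra | nra].
    - rewrite Rpow_mult_distr, <- pow_mult, <- Rmult_assoc.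
      eapply Rle_trans; [exact Hexp |]. apply exp_le_compat.
      apply Rle_trans with ((y ^ 2 / 2) ^ 2 / (8 * (4 * rho * y ^ 3))).
      + right. field. lra.
      + apply Rmult_le_compat.
        * apply pow2_ge_0.
        * left; apply Rinv_0_lt_compat. nra.
        * apply pow_incr. split; [|exact HS]. assert (H := pow2_ge_0 y). lra.
        * apply Rinv_le_contravar; lra. }
  rewrite exp_Ropp. fold X.
  apply Rmult_le_reg_r with (64 * K1 ^ 2 * X); [nra |].
  replace (2 * (K1 + 2) ^ 3 * (48 * K1) ^ 3 * / X * (64 * K1 ^ 2 * X))
    with (128 * 48 ^ 3 * ((K1 + 2) ^ 3 * K1 ^ 5)) by (field; lra).
  replace (/ (64 * K1 ^ 2) * (64 * K1 ^ 2 * X)) with X by (field; lra).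
  eapply Rle_trans; [|exact Hmain]. apply Rmult_le_compat_l; [lra |].
  replace ((K1 + 2) ^ 8) with ((K1 + 2) ^ 3 * (K1 + 2) ^ 5) by ring.
  apply Rmult_le_compat_l; [apply pow_le; lra | apply pow_incr; lra].
Qed.

(** With [lam j] the last exponent up to [n + rho sqrt n], the balanced radius tends to [rho],
    and every error in the position of the zero is of order [1 / y]. *)
Lemma zeros_eventually_near (z0 : C) (delta : R) :
  entire_coef lac -> z0 <> RtoC 0 -> 0 < delta ->
  exists N : nat, forall n, (N <= n)%nat ->
    exists z, Cmod (z - z0)%C < delta /\ CPS (shift_coef n lac) z = RtoC 0.
Proof.
  intros Hent Hz0 Hdelta. set (rho := Cmod z0).
  assert (Hrho : 0 < rho) by (apply Cmod_gt_0; exact Hz0).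
  set (kap := / (4 * (1 + rho))).
  assert (Hkap : 0 < kap) by (apply Rinv_0_lt_compat; lra).
  destruct (exp_dominates_pow (128 * 48 ^ 3 * (4 * rho + 2) ^ 8) (/ (128 * rho)) 24) as [Y0 HY0].
  { apply Rinv_0_lt_compat; lra. }
  (* [M / y] bounds the sum of the radial, the angular and the Newton displacement *)
  set (M := (rho ^ 2 + 1) / kap + 8 * rho + (rho + / kap)).
  set (Y := Rmax (Rmax 2 (/ (rho * kap))) (Rmax Y0 (M / delta + 1))).
  assert (HY1 : 2 <= Y) by (unfold Y; eapply Rle_trans; [apply Rmax_l | apply Rmax_l]).
  destruct (nfloor_ex (2 * Y ^ 6)) as [N0 [_ HN0]].
  { apply Rmult_le_pos; [lra | apply pow_le; lra]. }
  exists (S N0). intros n Hn.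
  assert (HnR : 2 * Y ^ 6 < INR n).
  { eapply Rlt_le_trans; [exact HN0 |]. rewrite <- S_INR. apply le_INR, Hn. }
  assert (Hn1 : (1 <= n)%nat) by lia.
  set (x := sqrt (INR n)).
  assert (HnR1 : 1 <= INR n) by (change 1 with (INR 1); apply le_INR; exact Hn1).
  assert (Hx1 : 1 <= x) by (unfold x; rewrite <- sqrt_1; apply sqrt_le_1_alt; exact HnR1).
  assert (Hxx : x * x = INR n) by (apply sqrt_sqrt; lra).
  destruct (lam_bracket (INR n + rho * x)) as [j Hj]; [nra |].
  destruct (gap_scale rho n j Hrho Hn1 Hj) as [Hs1 Hs2].
  set (g := (Nat.sqrt j + 1)%nat) in *.
  assert (Hg1 : 1 <= INR g) by (change 1 with (INR 1); apply le_INR; unfold g; lia).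
  set (y := sqrt (INR g)) in *. assert (Hyy : y * y = INR g) by (apply sqrt_sqrt; lra).
  assert (Hy0 : 0 <= y) by apply sqrt_pos.
  assert (HyY : Y <= y).
  { apply Rnot_lt_le. intros Hlt. rewrite <- Hyy in Hs1.
    assert (y ^ 6 <= Y ^ 6) by (apply pow_incr; lra).
    replace ((y * y) ^ 3) with (y ^ 6) in Hs1 by ring. lra. }
  assert (Hyb : / (rho * kap) <= y /\ Y0 <= y /\ M / delta + 1 <= y).
  { unfold Y in HyY. split; [|split]; (eapply Rle_trans; [|exact HyY]).
    - eapply Rle_trans; [apply Rmax_r | apply Rmax_l].
    - eapply Rle_trans; [apply Rmax_l | apply Rmax_r].
    - eapply Rle_trans; [apply Rmax_r | apply Rmax_r]. }
  destruct Hyb as [Hyr [HyY0 HyM]].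
  assert (Hy2 : 2 <= y) by lra.
  assert (Hg4 : 4 <= INR g) by nra.
  assert (Hg2 : (2 <= g)%nat) by (apply INR_le; simpl; lra).
  specialize (Hs2 Hg2). fold kap x in Hs2.
  assert (Hx2 : x <= 2 * y ^ 3).
  { apply Rsqr_incr_0_var; [|apply Rmult_le_pos; [lra | apply pow_le; lra]].
    unfold Rsqr. rewrite Hxx. eapply Rle_trans; [exact Hs1 |]. rewrite <- Hyy.
    assert (0 <= (y * y) ^ 3) by (apply pow_le; nra).
    replace (2 * y ^ 3 * (2 * y ^ 3)) with (4 * (y * y) ^ 3) by ring. lra. }
  assert (Hky : 1 <= rho * kap * y).
  { apply (Rmult_le_compat_l (rho * kap)) in Hyr; [|nra].
    rewrite Rinv_r in Hyr by nra. exact Hyr. }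
  assert (Hgx : kap * y * INR g <= x) by (rewrite <- Hyy; simpl in Hs2; nra).
  assert (Hgrx : INR g <= rho * x).
  { assert (rho * (kap * y * INR g) <= rho * x) by (apply Rmult_le_compat_l; lra). nra. }
  assert (HlamS : INR (lam (S j)) = INR (lam j) + INR g).
  { rewrite lam_S. fold g. apply plus_INR. }
  assert (Hle : (n <= lam j)%nat) by (apply INR_le; lra).
  set (k0 := (lam j - n)%nat).
  assert (Hk0 : lam j = (n + k0)%nat) by (unfold k0; lia).
  assert (Hk0R : INR (lam j) = INR n + INR k0) by (rewrite Hk0; apply plus_INR).
  set (k1 := (k0 + g)%nat).
  assert (Hk1R : INR k1 = INR k0 + INR g) by apply plus_INR.
  assert (Hk0p := pos_INR k0).
  destruct (balanced_radius n k0 g Hn1 ltac:(lia)) as [r [Hr [Hbal [Hrl Hru]]]].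
  fold k1 in Hbal, Hru. fold x in Hru.
  assert (Hnk : INR (n + k0 + g) = INR n + INR k1) by (rewrite !plus_INR, Hk1R; ring).
  rewrite Hnk in Hrl.
  assert (Hxrho : sqrt (INR n + INR k1) <= x + rho).
  { rewrite <- (sqrt_Rsqr (x + rho)) by lra. apply sqrt_le_1_alt. unfold Rsqr. nra. }
  assert (Hsq0 : 0 < sqrt (INR n + INR k1)) by (apply sqrt_lt_R0; lra).
  assert (Hkx : / x <= / (kap * y * INR g)) by (apply Rinv_le_contravar; [nra | exact Hgx]).
  assert (Hgx' : INR g / x <= / kap / y).
  { unfold Rdiv. apply Rle_trans with (INR g * / (kap * y * INR g)).
    - apply Rmult_le_compat_l; lra.
    - right. field. lra. }
  assert (Hky0 : 0 < / kap) by (apply Rinv_0_lt_compat; exact Hkap).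
  assert (Hyinv : 0 < / y) by (apply Rinv_0_lt_compat; lra).
  assert (Hr_up : r <= rho + / kap / y).
  { eapply Rle_trans; [exact Hru |]. apply Rle_trans with ((rho * x + INR g) / x).
    - apply Rmult_le_compat_r; [left; apply Rinv_0_lt_compat; lra | lra].
    - replace ((rho * x + INR g) / x) with (rho + INR g / x) by (field; lra). lra. }
  assert (Hr_low : rho - (rho ^ 2 + 1) / kap / y <= r).
  { apply Rle_trans with (rho - (rho ^ 2 + INR g) / x).
    - assert (Hrx : / x <= / kap / y).
      { apply Rle_trans with (INR g / x); [|exact Hgx'].
        rewrite <- (Rmult_1_l (/ x)). apply Rmult_le_compat_r; [left; apply Rinv_0_lt_compat; lra | lra]. }
      replace ((rho ^ 2 + INR g) / x) with (rho ^ 2 * / x + INR g / x) by (field; lra).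
      replace ((rho ^ 2 + 1) / kap / y) with (rho ^ 2 * (/ kap / y) + / kap / y) by (field; lra).
      assert (rho ^ 2 * / x <= rho ^ 2 * (/ kap / y)) by (apply Rmult_le_compat_l; [apply pow2_ge_0 | exact Hrx]).
      lra.
    - eapply Rle_trans; [|exact Hrl].
      apply Rle_trans with (INR k0 / (x + rho)).
      + apply Rle_div_r; [lra |].
        apply Rle_trans with (rho * x - INR g); [|lra].
        assert (Hid : (rho - (rho ^ 2 + INR g) / x) * (x + rho)
                = rho * x - INR g - rho * (rho ^ 2 + INR g) / x) by (field; lra).
        rewrite Hid.
        assert (0 <= rho * (rho ^ 2 + INR g) / x); [|lra].
        apply Rmult_le_pos; [|left; apply Rinv_0_lt_compat; lra]. nra.
      + apply Rmult_le_compat_l; [exact Hk0p |]. apply Rinv_le_contravar; assumption. }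
  assert (Hky1 : / kap / y <= (rho ^ 2 + 1) / kap / y).
  { unfold Rdiv. rewrite Rmult_assoc. assert (H : 0 < / kap * / y) by (apply Rmult_lt_0_compat; lra).
    assert (H' := pow2_ge_0 rho). nra. }
  destruct (opposite_root_near z0 r g ltac:(lra) ltac:(lia)) as [zeta [Hzm [Hzg Hzd]]].
  fold rho in Hzd.
  destruct (shift_lac_zero n j k0 r zeta Hent Hk0 Hg2 Hr Hbal Hzm Hzg) as [u [Hu Hzero]].
  { fold g k1. apply (lac_tail_small rho y); try lra.
    - nra.
    - apply HY0; lra. }
  fold g k1 in Hu.
  exists (zeta * (1 + u))%C. split; [|exact Hzero].
  replace (zeta * (1 + u) - z0)%C with ((zeta - z0) + zeta * u)%C by ring.
  eapply Rle_lt_trans; [apply Cmod_triangle |]. rewrite Cmod_mult, Hzm.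
  assert (Hd1 : Rabs (r - rho) <= (rho ^ 2 + 1) / kap / y) by (apply Rabs_le; lra).
  assert (Hd2 : 8 * rho / INR g <= 8 * rho / y).
  { apply Rmult_le_compat_l; [lra |]. apply Rinv_le_contravar; nra. }
  assert (Hd3 : r * Cmod u <= (rho + / kap) / y).
  { apply Rmult_le_compat; [lra | apply Cmod_ge_0 | |].
    - assert (/ kap / y <= / kap); [|lra].
      rewrite <- (Rmult_1_r (/ kap)) at 2. apply Rmult_le_compat_l; [lra |].
      rewrite <- Rinv_1. apply Rinv_le_contravar; lra.
    - eapply Rle_trans; [exact Hu |]. apply Rinv_le_contravar; [lra |].
      assert (y <= INR k1) by nra. nra. }
  assert (Hsum : (rho ^ 2 + 1) / kap / y + 8 * rho / y + (rho + / kap) / y = M / y)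
    by (unfold M; field; lra).
  apply Rle_lt_trans with (M / y); [lra |].
  apply Rlt_div_l; [lra |].
  assert (HM : M < y * delta); [|lra].
  apply Rlt_div_l; lra.
Qed.

(** * Growth *)

Lemma is_series_exp (x : R) : is_series (fun m => x ^ m / INR (fact m)) (exp x).
Proof.
  eapply is_series_ext; [|exact (is_exp_Reals x)].
  intros m; simpl. change scal with Rmult. rewrite pow_n_pow. reflexivity.
Qed.

Lemma lac_nonneg (m : nat) : 0 <= lac m.
Proof.
  unfold lac. destruct (is_lam m); [left; apply Rinv_0_lt_compat, sqrt_fact_pos | lra].
Qed.

(** The inequality [2 a b <= t a^2 + b^2 / t] with [a^2 = (2 r^2)^m / m!] and
    [b^2 = 2^-m]; both squares have known sums. *)
Lemma lac_term_le (t r : R) (m : nat) : 0 < t -> 0 <= r ->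
  Rabs (lac m) * r ^ m <= t / 2 * ((2 * r ^ 2) ^ m / INR (fact m)) + / (2 * t) * (/ 2) ^ m.
Proof.
  intros Ht Hr. rewrite Rabs_pos_eq by apply lac_nonneg.
  assert (Hs := sqrt_fact_pos m). set (s := sqrt (INR (fact m))) in *.
  assert (Hss : s * s = INR (fact m)) by (apply sqrt_sqrt; left; apply INR_fact_lt_0).
  assert (Hrm : 0 <= r ^ m) by (apply pow_le; exact Hr).
  apply Rle_trans with (/ s * r ^ m).
  { apply Rmult_le_compat_r; [exact Hrm |]. unfold lac. destruct (is_lam m); [apply Rle_refl |].
    left; apply Rinv_0_lt_compat, Hs. }
  rewrite <- Hss. rewrite Rpow_mult_distr, <- pow_mult, Nat.mul_comm, pow_mult, pow_inv.
  assert (H2 : 0 < 2 ^ m) by (apply pow_lt; lra).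
  set (a := r ^ m) in *. set (b := 2 ^ m) in *. clearbody a b s.
  assert (Hsq : 0 <= (t * b * a - s) ^ 2) by apply pow2_ge_0.
  apply Rmult_le_reg_r with (2 * t * b * s ^ 2).
  { repeat apply Rmult_lt_0_compat; try lra. }
  replace (/ s * a * (2 * t * b * s ^ 2)) with (2 * t * b * a * s) by (field; lra).
  replace ((t / 2 * (b * a ^ 2 / (s * s)) + / (2 * t) * / b) * (2 * t * b * s ^ 2))
    with ((t * b * a) ^ 2 + s ^ 2) by (field; lra).
  nra.
Qed.

Lemma is_series_lac_bound (t r : R) :
  is_series (fun m => t / 2 * ((2 * r ^ 2) ^ m / INR (fact m)) + / (2 * t) * (/ 2) ^ m)
            (t / 2 * exp (2 * r ^ 2) + / (2 * t) * 2).
Proof.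
  apply (is_series_plus (fun m => t / 2 * ((2 * r ^ 2) ^ m / INR (fact m)))).
  - apply (is_series_scal_l (t / 2) (fun m => (2 * r ^ 2) ^ m / INR (fact m))), is_series_exp.
  - apply (is_series_scal_l (/ (2 * t)) (fun m => (/ 2) ^ m)).
    assert (H := is_series_geom (/ 2)). replace (/ (1 - / 2)) with 2 in H by field.
    apply H. rewrite Rabs_pos_eq; lra.
Qed.

Lemma entire_coef_lac : entire_coef lac.
Proof.
  intros r Hr.
  apply (ex_series_dominated _ (fun m => 1 / 2 * ((2 * r ^ 2) ^ m / INR (fact m)) + / (2 * 1) * (/ 2) ^ m)).
  - intros m. rewrite Rabs_pos_eq.
    + apply lac_term_le; lra.
    + apply Rmult_le_pos; [apply Rabs_pos | apply pow_le; exact Hr].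
  - eexists; apply is_series_lac_bound.
Qed.

Lemma Cmod_lac_le (z : C) : Cmod (CPS lac z) <= sqrt 2 * exp (Cmod z ^ 2).
Proof.
  set (r := Cmod z). assert (Hr : 0 <= r) by apply Cmod_ge_0.
  assert (H2 : 0 < sqrt 2) by (apply sqrt_lt_R0; lra).
  assert (H22 : sqrt 2 * sqrt 2 = 2) by (apply sqrt_sqrt; lra).
  set (e := exp (r ^ 2)). assert (He : 0 < e) by apply exp_pos.
  (* this value of the parameter makes the two sums of the mean equal *)
  set (t := sqrt 2 / e). assert (Ht : 0 < t) by (apply Rdiv_lt_0_compat; assumption).
  assert (Hsum : t / 2 * exp (2 * r ^ 2) + / (2 * t) * 2 = sqrt 2 * e).
  { replace (exp (2 * r ^ 2)) with (e * e) by (unfold e; rewrite <- exp_plus; f_equal; ring).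
    unfold t. replace (/ (2 * (sqrt 2 / e)) * 2) with (e * (sqrt 2 / (sqrt 2 * sqrt 2))) by (field; lra).
    rewrite H22. field. lra. }
  eapply Rle_trans; [apply Cmod_CSeries_le, ex_CPS, entire_coef_lac |].
  rewrite <- Hsum, <- (is_series_unique _ _ (is_series_lac_bound t r)).
  apply Series_le; [|eexists; apply is_series_lac_bound].
  intros m. split; [apply Cmod_ge_0 |].
  rewrite Cmod_mult, Cmod_pow, Cmod_R. apply lac_term_le; assumption.
Qed.

Lemma lac_term_le_Cmod (r : R) (j : nat) : 0 <= r ->
  r ^ lam j / sqrt (INR (fact (lam j))) <= Cmod (CPS lac r).
Proof.
  intros Hr. eapply Rle_trans; [|apply Cmod_fst]. eapply Rle_trans; [|apply Rle_abs].
  change (fst (CPS lac r)) with (Series (fun m => fst (lac m * r ^ m)%C)).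
  rewrite <- (is_series_unique _ _ (is_series_single (lam j) (r ^ lam j / sqrt (INR (fact (lam j)))))).
  assert (Hfst : forall m, fst (lac m * r ^ m)%C = lac m * r ^ m).
  { intros m. rewrite <- RtoC_pow, <- RtoC_mult. reflexivity. }
  apply Series_le.
  - intros m. rewrite Hfst. destruct (Nat.eqb_spec m (lam j)) as [-> |].
    + unfold lac. rewrite is_lam_lam.
      assert (H1 := sqrt_fact_pos (lam j)).
      assert (H2 : 0 < / sqrt (INR (fact (lam j)))) by (apply Rinv_0_lt_compat, H1).
      assert (H3 : 0 <= r ^ lam j) by (apply pow_le; exact Hr).
      unfold Rdiv. split; [apply Rmult_le_pos; lra | lra].
    + split; [lra |]. apply Rmult_le_pos; [apply lac_nonneg | apply pow_le; exact Hr].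
  - apply ex_Cseries_fst, (ex_CPS lac r entire_coef_lac).
Qed.

Lemma polynomial_growth (d : nat) (b : nat -> C) :
  exists K, 0 <= K /\ forall z : C, 1 <= Cmod z ->
    Cmod (sum_n (fun k => b k * z ^ k)%C d) <= K * Cmod z ^ d.
Proof.
  induction d as [|d [K [HK IH]]].
  - exists (Cmod (b O)). split; [apply Cmod_ge_0 |]. intros z Hz.
    rewrite sum_O. simpl. rewrite Cmult_1_r. lra.
  - exists (K + Cmod (b (S d))). assert (Hb := Cmod_ge_0 (b (S d))). split; [lra |].
    intros z Hz. rewrite sum_Sn. eapply Rle_trans; [apply Cmod_triangle |].
    rewrite Cmod_mult, Cmod_pow, Rmult_plus_distr_r. apply Rplus_le_compat_r.
    eapply Rle_trans; [apply IH, Hz |]. apply Rmult_le_compat_l; [exact HK |].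
    apply Rle_pow; [exact Hz | lia].
Qed.

(** A polynomial of degree [d] cannot dominate the single term of exponent [lam (d + 1) > d]. *)
Lemma lac_not_polynomial : ~ polynomial (CPS lac).
Proof.
  intros [d [b Hb]]. destruct (polynomial_growth d b) as [K [HK Hgrow]].
  set (s := sqrt (INR (fact (lam (S d))))).
  assert (Hs : 0 < s) by apply sqrt_fact_pos.
  set (r := K * s + 1). assert (Hr : 1 <= r) by (unfold r; nra).
  assert (H1 := lac_term_le_Cmod r (S d) ltac:(lra)). fold s in H1.
  assert (Hmod : Cmod r = r) by (rewrite Cmod_R; apply Rabs_pos_eq; lra).
  assert (H2 := Hgrow r ltac:(rewrite Hmod; exact Hr)). rewrite <- Hb, Hmod in H2.
  assert (H3 : r ^ S d <= r ^ lam (S d)) by (apply Rle_pow; [exact Hr | apply lam_ge]).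
  assert (Hrd : 0 < r ^ d) by (apply pow_lt; lra).
  assert (H4 : r ^ lam (S d) <= K * r ^ d * s) by (apply Rle_div_l; lra).
  rewrite <- tech_pow_Rmult in H3.
  assert (H5 : r * r ^ d = K * r ^ d * s + r ^ d) by (unfold r at 1; ring).
  lra.
Qed.

Lemma max_modulus_bounds (f : C -> C) (r B : R) : 0 <= r ->
  (forall z, Cmod z = r -> Cmod (f z) <= B) ->
  Cmod (f r) <= max_modulus f r <= B.
Proof.
  intros Hr HB. unfold max_modulus.
  set (E := fun y : R => exists z : C, Cmod z = r /\ y = Cmod (f z)).
  destruct (Lub_Rbar_correct E) as [Hub Hleast].
  assert (H1 : Rbar_le (Cmod (f r)) (Lub_Rbar E)).
  { apply Hub. exists r. rewrite Cmod_R, Rabs_pos_eq by exact Hr. auto. }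
  assert (H2 : Rbar_le (Lub_Rbar E) B).
  { apply Hleast. intros y [z [Hz ->]]. apply HB, Hz. }
  destruct (Lub_Rbar E); simpl in *; tauto.
Qed.

Lemma LimSup_p_infty_eq (u : R -> R) (l : R) :
  (forall eps, 0 < eps -> exists a, forall r, a < r -> u r <= l + eps) ->
  (forall eps a, 0 < eps -> exists r, a < r /\ l - eps <= u r) ->
  LimSup_p_infty u = Finite l.
Proof.
  intros Hup Hlow. apply Rbar_is_glb_unique. split.
  - intros s [a ->].
    destruct (Lub_Rbar_correct (fun y => exists r, a < r /\ y = u r)) as [Hub _].
    assert (H : forall eps, 0 < eps ->
        Rbar_le (l - eps) (Lub_Rbar (fun y => exists r, a < r /\ y = u r))).
    { intros eps Heps. destruct (Hlow eps a Heps) as [r [Hr Hu]].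
      apply Rbar_le_trans with (u r); [exact Hu |]. apply Hub. now exists r. }
    destruct (Lub_Rbar _) as [x | |].
    + simpl. apply le_epsilon. intros eps Heps. specialize (H eps Heps). simpl in H. lra.
    + exact I.
    + exact (H 1 Rlt_0_1).
  - intros b Hb.
    assert (H : forall eps, 0 < eps -> Rbar_le b (l + eps)).
    { intros eps Heps. destruct (Hup eps Heps) as [a Ha].
      eapply Rbar_le_trans; [apply Hb; now exists a |].
      apply (proj2 (Lub_Rbar_correct _)). intros y [r [Hr ->]]. apply Ha, Hr. }
    destruct b as [x | |].
    + simpl. apply le_epsilon. exact H.
    + exact (H 1 Rlt_0_1).
    + exact I.
Qed.

Lemma fact_le_pow (n : nat) : (fact n <= n ^ n)%nat.
Proof.
  induction n as [|n IH]; [simpl; lia |]. rewrite fact_simpl, Nat.pow_succ_r'.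
  apply Nat.mul_le_mono_l. eapply Nat.le_trans; [exact IH |]. apply Nat.pow_le_mono_l. lia.
Qed.

(** At radius [e sqrt(lam j)] the single term of exponent [lam j] already reaches
    [exp (lam j)], since [m! <= m^m]. *)
Lemma lac_large (j : nat) : (1 <= j)%nat ->
  exp (INR (lam j)) <= Cmod (CPS lac (exp 1 * sqrt (INR (lam j)))%R).
Proof.
  intros Hj. assert (Hl := lam_ge j).
  assert (Hl0 : 0 < INR (lam j)) by (apply lt_0_INR; lia).
  assert (Hsl : 0 < sqrt (INR (lam j))) by (apply sqrt_lt_R0, Hl0).
  assert (He := exp_pos 1).
  eapply Rle_trans; [|apply lac_term_le_Cmod; left; apply Rmult_lt_0_compat; assumption].
  apply Rle_div_r; [apply sqrt_fact_pos |].
  rewrite Rpow_mult_distr, exp_pow, Rmult_1_r.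
  apply Rmult_le_compat_l; [left; apply exp_pos |].
  apply Rsqr_incr_0_var; [|apply pow_le; lra].
  rewrite Rsqr_sqrt by (left; apply INR_fact_lt_0).
  unfold Rsqr. rewrite <- Rpow_mult_distr, sqrt_sqrt by lra.
  rewrite <- pow_INR. apply le_INR, fact_le_pow.
Qed.

Lemma entire_order_lac : entire_order (CPS lac) = Finite 2.
Proof.
  assert (Hmax : forall r, 0 <= r ->
      Cmod (CPS lac r) <= max_modulus (CPS lac) r <= sqrt 2 * exp (r ^ 2)).
  { intros r Hr. apply max_modulus_bounds; [exact Hr |].
    intros z <-. apply Cmod_lac_le. }
  apply LimSup_p_infty_eq.
  - intros eps Heps. exists (exp (1 + 1 / eps)). intros r Hr.
    assert (Hinv : 0 < 1 / eps) by (apply Rdiv_lt_0_compat; lra).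
    assert (Hr2 : 2 < r).
    { assert (H := exp_ineq1_le (1 + 1 / eps)). lra. }
    assert (Hlnr : 1 + 1 / eps < ln r).
    { rewrite <- (ln_exp (1 + 1 / eps)). apply ln_increasing; [apply exp_pos | exact Hr]. }
    destruct (Hmax r ltac:(lra)) as [Hlo Hhi].
    set (M := max_modulus (CPS lac) r) in *.
    assert (HrM : r <= M).
    { eapply Rle_trans; [|exact Hlo].
      assert (H := lac_term_le_Cmod r 1 ltac:(lra)). simpl in H. rewrite sqrt_1 in H. lra. }
    assert (HlnM : 0 < ln M) by (rewrite <- ln_1; apply ln_increasing; lra).
    assert (HlnM2 : ln M <= 2 * r ^ 2).
    { rewrite <- (ln_exp (2 * r ^ 2)). apply ln_le; [lra |].
      eapply Rle_trans; [exact Hhi |].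
      replace (2 * r ^ 2) with (r ^ 2 + r ^ 2) by ring. rewrite exp_plus.
      apply Rmult_le_compat_r; [left; apply exp_pos |].
      assert (H := exp_ineq1_le (r ^ 2)).
      assert (sqrt 2 <= 2) by (rewrite <- (sqrt_pow2 2) at 2 by lra; apply sqrt_le_1_alt; lra).
      nra. }
    assert (Hlnln : ln (ln M) <= 2 * ln r + 1).
    { eapply Rle_trans; [apply ln_le; [exact HlnM | exact HlnM2] |].
      replace (2 * r ^ 2) with (2 * (r * r)) by ring.
      rewrite !ln_mult by nra.
      assert (ln 2 <= 1); [|lra].
      rewrite <- (ln_exp 1). apply ln_le; [lra |].
      assert (H := exp_ineq1_le 1). lra. }
    apply Rle_div_l; [lra |].
    assert (1 <= eps * ln r).
    { assert (eps * (1 + 1 / eps) <= eps * ln r) by (apply Rmult_le_compat_l; lra).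
      replace (eps * (1 + 1 / eps)) with (eps + 1) in * by (field; lra). lra. }
    lra.
  - intros eps a Heps.
    set (L := Rmax (exp a) (exp (1 + 2 / eps))).
    destruct (nfloor_ex (L ^ 2)) as [j [_ Hj]]; [apply pow2_ge_0 |].
    rewrite <- S_INR in Hj.
    assert (Hlj : INR (S j) <= INR (lam (S j))) by (apply le_INR, lam_ge).
    set (l := INR (lam (S j))) in *.
    assert (HL0 : 0 < L) by (eapply Rlt_le_trans; [apply (exp_pos a) | apply Rmax_l]).
    assert (HL : L <= sqrt l).
    { rewrite <- (sqrt_pow2 L) by lra. apply sqrt_le_1_alt. lra. }
    assert (Hinv : 0 < 2 / eps) by (apply Rdiv_lt_0_compat; lra).
    assert (He1 := exp_ineq1_le 1).
    set (r := exp 1 * sqrt l).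
    assert (HLr : L <= r) by (unfold r; nra).
    assert (Hl1 : 1 <= l).
    { eapply Rle_trans; [|exact Hlj]. change 1 with (INR 1). apply le_INR; lia. }
    assert (Har : a < r).
    { assert (H := exp_ineq1_le a). assert (H' := Rmax_l (exp a) (exp (1 + 2 / eps))).
      fold L in H'. lra. }
    exists r. split; [exact Har |].
    destruct (Hmax r ltac:(lra)) as [Hlo _].
    assert (Hlarge := lac_large (S j) ltac:(lia)). fold l r in Hlarge.
    set (M := max_modulus (CPS lac) r) in *.
    assert (HlnM : l <= ln M).
    { rewrite <- (ln_exp l). apply ln_le; [apply exp_pos | lra]. }
    assert (Hlnln : ln l <= ln (ln M)) by (apply ln_le; lra).
    assert (Hsl : 0 < sqrt l) by (apply sqrt_lt_R0; lra).
    assert (Hlnr : ln r = 1 + ln l / 2).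
    { unfold r. rewrite ln_mult, ln_exp by (exact Hsl || apply exp_pos).
      rewrite <- (sqrt_sqrt l) at 2 by lra. rewrite ln_mult by exact Hsl. field. }
    assert (Hlnr2 : 1 + 2 / eps <= ln r).
    { rewrite <- (ln_exp (1 + 2 / eps)). apply ln_le; [apply exp_pos |].
      eapply Rle_trans; [apply Rmax_r | exact HLr]. }
    apply Rle_div_r; [lra |].
    assert (2 <= eps * ln r).
    { assert (eps * (1 + 2 / eps) <= eps * ln r) by (apply Rmult_le_compat_l; lra).
      replace (eps * (1 + 2 / eps)) with (eps + 2) in * by (field; lra). lra. }
    nra.
Qed.

Lemma open_contains_disc (U : C -> Prop) : open U -> (exists z, U z) ->
  exists z0 delta, z0 <> RtoC 0 /\ 0 < delta /\ forall z, Cmod (z - z0)%C < delta -> U z.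
Proof.
  intros HU [z1 Hz1].
  assert (Hdisc : exists d, 0 < d /\ forall z, Cmod (z - z1)%C < d -> U z).
  { destruct (HU z1 Hz1) as [d Hd]. exists d. split; [apply cond_pos |].
    intros z Hz. apply Hd. apply C_NormedModule_mixin_compat1. exact Hz. }
  destruct Hdisc as [d [Hd HdU]].
  destruct (Req_dec (Cmod z1) 0) as [H0 | H0].
  - (* a disc centred at zero contains a smaller one centred elsewhere *)
    exists (RtoC (d / 2)), (d / 2). apply Cmod_eq_0 in H0. subst z1. split; [|split].
    + intros H. apply RtoC_inj in H. lra.
    + lra.
    + intros z Hz. apply HdU. replace (z - 0)%C with (z - RtoC (d / 2) + RtoC (d / 2))%C by ring.
      eapply Rle_lt_trans; [apply Cmod_triangle |].
      rewrite (Cmod_R (d / 2)), Rabs_pos_eq by lra. lra.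
  - exists z1, d. split; [|split; assumption].
    intros ->. apply H0, Cmod_0.
Qed.

Theorem theorem1p2 :
  exists f : C -> C,
    transcendental_entire f /\
    (forall U : C -> Prop, open U -> (exists z : C, U z) ->
       exists N : nat, forall n : nat, (N <= n)%nat ->
         exists z : C, U z /\ C_derive_n f n z = RtoC 0) /\
    entire_order f = Finite 2 /\
    (forall z : C, Cmod (f z) <= sqrt 2 * exp (Cmod z ^ 2)) /\
    (forall n : nat -> nat, (forall k : nat, (n k < n (S k))%nat) ->
       dense_in_C (fun z : C => exists k : nat, C_derive_n f (n k) z = RtoC 0)).
Proof.
  assert (Ha : forall U : C -> Prop, open U -> (exists z : C, U z) ->
       exists N : nat, forall n : nat, (N <= n)%nat ->
         exists z : C, U z /\ C_derive_n (CPS lac) n z = RtoC 0).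
  { intros U HU Hne.
    destruct (open_contains_disc U HU Hne) as [z0 [delta [Hz0 [Hdelta Hdisc]]]].
    destruct (zeros_eventually_near z0 delta entire_coef_lac Hz0 Hdelta) as [N HN].
    exists N. intros n Hn. destruct (HN n Hn) as [z [Hz Hzero]].
    exists z. split; [apply Hdisc, Hz |].
    rewrite C_derive_n_CPS; [exact Hzero | exact entire_coef_lac]. }
  exists (CPS lac). split; [split|split; [|split; [|split]]].
  - intros z. eexists. apply is_derive_CPS, entire_coef_lac.
  - exact lac_not_polynomial.
  - exact Ha.
  - exact entire_order_lac.
  - exact Cmod_lac_le.
  - intros n Hn U HU Hne. destruct (Ha U HU Hne) as [N HN].
    assert (Hmono : forall k, (k <= n k)%nat).
    { induction k as [|k IH]; [lia |]. specialize (Hn k). lia. }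
    destruct (HN (n N) (Hmono N)) as [z [Hz Hzero]].
    exists z. split; [exact Hz |]. now exists N.
Qed.
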